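(* Let $d\ge 2$, $1\le k\le d$, and let $A_1,\dots,A_k$ be finite sets of hyperplanes in $\mathbb{R}^d$ (each with at least $d-1$ elements). There exists a $(k-1)$-flat $\pi$ such that for every open halfspace $h$ containing $\pi$ and every $i\in\{1,\dots,k\}$, $$(d-k+2)\,\mu_{A_i}(h)\ge |A_i|,$$ where the multiple is taken with respect to $\oplus$.
   Context: For a finite set $A$ of hyperplanes in $\mathbb{R}^d$, $V(A)$ is the set of points that are the unique common point of some $d$ hyperplanes of $A$, and $\mu_A(S)=\max\{|A'| : A'\subseteq A,\ V(A')\subseteq S\}$. The operation $\oplus$ on integers $\ge d-1$ is $a\oplus b=R_d(a+1,b+1)-1$, where $R_d(a,b)$ is the hypergraph Ramsey number (least $R$ such that every 2-colouring of the $d$-subsets of an $R$-set contains an $a$-set with all $d$-subsets of colour 1 or a $b$-set with all $d$-subsets of colour 2). For a positive integer $c$, $cx$ denotes $x\oplus(x\oplus(\cdots\oplus x)\cdots)$ with $c$ copies of $x$. *)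

(* Defs.v *)
From HB Require Import structures.
From mathcomp Require Import all_boot all_order all_algebra.
From Stdlib Require Import ClassicalEpsilon.
Set Implicit Arguments. Unset Strict Implicit. Unset Printing Implicit Defensive.
Import Order.TTheory GRing.Theory Num.Theory.
Local Open Scope ring_scope.

Definition asbool (P : Prop) : bool :=
  if excluded_middle_informative P then true else false.

Definition ramsey_prop (d a b R : nat) : Prop :=
  forall c : {set 'I_R} -> bool,
    (exists X : {set 'I_R}, #|X| = a /\
        forall Y : {set 'I_R}, Y \subset X -> #|Y| = d -> c Y) \/
    (exists X : {set 'I_R}, #|X| = b /\
        forall Y : {set 'I_R}, Y \subset X -> #|Y| = d -> c Y = false).

(* R_d(a,b): the least R with ramsey_prop (0 if no such R exists; by Ramsey's
   theorem it always exists). *)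
Definition ramsey (d a b : nat) : nat :=
  match excluded_middle_informative
          (exists R : nat, asbool (ramsey_prop d a b R)) with
  | left h => ex_minn h
  | right _ => 0
  end.

Definition oplus (d a b : nat) : nat := (ramsey d a.+1 b.+1).-1.

Definition mult (d c x : nat) : nat := iter c.-1 (oplus d x) x.

Definition dot (R : rcfType) (d : nat) (u v : 'rV[R]_d) : R := (u *m v^T) 0 0.

(* a hyperplane {x | a . x = b}, represented by (a, b) with a <> 0 *)
Definition hyp (R : rcfType) (d : nat) := ('rV[R]_d * R)%type.

Definition on_hyp (R : rcfType) (d : nat) (H : hyp R d) (x : 'rV[R]_d) : Prop :=
  dot H.1 x = H.2.

(* A finite set of hyperplanes, given as a list s of hyperplanes that are all
   genuine (nonzero normal) and pairwise distinct (as point sets). *)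
Definition hyp_set (R : rcfType) (d : nat) (s : seq (hyp R d)) : Prop :=
  (forall j : 'I_(size s), (nth (0, 0) s j).1 != 0) /\
  (forall j1 j2 : 'I_(size s), j1 != j2 ->
     ~ (forall x, on_hyp (nth (0, 0) s j1) x <-> on_hyp (nth (0, 0) s j2) x)).

Definition Vset (R : rcfType) (d : nat) (s : seq (hyp R d))
    (T : {set 'I_(size s)}) (p : 'rV[R]_d) : Prop :=
  exists U : {set 'I_(size s)}, U \subset T /\ #|U| = d /\
    forall x, (forall j, j \in U -> on_hyp (nth (0, 0) s j) x) <-> x = p.

Definition mu (R : rcfType) (d : nat) (s : seq (hyp R d)) (S : 'rV[R]_d -> Prop)
  : nat :=
  (\max_(T : {set 'I_(size s)} | asbool (forall p, Vset T p -> S p)) #|T|)%N.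

(* the (k-1)-flat {x | x - p in rowspace M} with \rank M = k-1 *)
Definition in_flat (R : rcfType) (d : nat) (p : 'rV[R]_d) (M : 'M[R]_d)
  (x : 'rV[R]_d) : bool := (x - p <= M)%MS.

(* Main.v *)
(** A point [p] and the directions [u] of an [m]-dimensional space [L], [m = d - k + 1], solve the
    problem for [A_i] when for every [u] in [L] some large [T] in [A_i] has [p . u <= q . u] for all
    its vertices [q]; the flat is then [p] plus the orthogonal complement of [L]. For fixed [L] such a
    [p] exists by Helly's theorem: an infeasible system has a certificate with at most [m + 1]
    directions [u_j], summing to 0, which colours the vertices with [m + 1] colours and contradicts
    Ramsey's theorem, as [|A_i| <= (m + 1) |T|] for a monochromatic [T].

    To choose [L] so that one [p] serves all [k] sets, select approximate center points
    continuously in a frame [u_1, ..., u_m] and make the [k] selections agree. Restricting [u_l] to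
    the sphere of a coordinate space of dimension [k - 1 + l], the equations "the selections agree in
    direction [u_l]" and "[u_l] is orthogonal to [u_l']" are as many as the dimension of the product of
    spheres, and are odd or even under each antipode; a mod 2 count of flags of a cubical
    subdivision (a cup product in cohomology) shows that they have a common zero.

    This uses compactness, hence the real numbers. For given combinatorial data the existence of
    [p] and [L] is a first-order sentence without parameters, so quantifier elimination
    transfers it to every real closed field. *)

(* Why the count is odd: write n = k - 1 and let t_l, l < m, be the class of the l-th antipode in
   the mod 2 cohomology of the product of projective spaces of dimensions n + l. Agreement
   contributes t_l^n for each l, and orthogonality contributes the product of the t_l + t_l' over l'
   < l, a Vandermonde determinant. As t_l^(n+l+1) = 0, the only surviving monomial is the product of
   the t_l^(n+l), with coefficient 1. Here this computation is done on an explicit model, from which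
   equations are removed one at a time, lowest block first, each removal lowering the dimension of
   one sphere by 1.

   Why a continuous selection exists: in a fixed direction, the condition that some T works is a
   single linear inequality, so approximate center points form a convex set. A mean over a finite
   net, with weights positive exactly at the approximate center points, is therefore again one, and
   it is continuous in the frame and equivariant under antipodes. Such weights can test only
   finitely many directions; finer nets and compactness remove the tolerance. *)
Require Import Defs.
From HB Require Import structures.
From mathcomp Require Import all_boot all_order all_algebra.
From mathcomp Require Import zify ring lra.
From mathcomp Require qe_rcf_th ordered_qelim qe_rcf.
From mathcomp Require boolp classical_sets reals topology normedtype sequences Rstruct.
From Stdlib Require Import ClassicalEpsilon FunctionalExtensionality Classical.
Set Implicit Arguments. Unset Strict Implicit. Unset Printing Implicit Defensive.
Import Order.TTheory GRing.Theory Num.Theory.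
Local Open Scope ring_scope.

(** * Transfer between real closed fields *)

Section Transfer.
Import qe_rcf_th ordered_qelim qe_rcf.

(* Quantifier elimination only branches on formulas and only introduces rational constants, so it
   commutes with a change of the field of constants. *)
Section TermMap.
Variables (K L : realFieldType) (h : {rmorphism K -> L}).

Fixpoint term_map (t : term K) : term L :=
  match t with
  | Var i => Var _ i
  | Const c => Const (h c)
  | NatConst n => NatConst _ n
  | Add a b => Add (term_map a) (term_map b)
  | Opp a => Opp (term_map a)
  | NatMul a n => NatMul (term_map a) n
  | Mul a b => Mul (term_map a) (term_map b)
  | Exp a n => Exp (term_map a) n
  end.

Fixpoint formula_map (f : formula K) : formula L :=
  match f with
  | Bool b => Bool b
  | Equal a b => Equal (term_map a) (term_map b)
  | Lt a b => Lt (term_map a) (term_map b)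
  | Le a b => Le (term_map a) (term_map b)
  | And f g => And (formula_map f) (formula_map g)
  | Or f g => Or (formula_map f) (formula_map g)
  | Implies f g => Implies (formula_map f) (formula_map g)
  | Not f => Not (formula_map f)
  end.

Let fm := formula_map.
Let tm := term_map.
Let pm : polyF K -> polyF L := map tm.
Let psm : seq (polyF K) -> seq (polyF L) := map pm.

(** The operations are in continuation-passing style, so each of these lemmas assumes that the
    continuations correspond and concludes that the resulting formulas do. *)
Lemma Size_map p k k' : (forall n, fm (k n) = k' n) -> fm (Size p k) = Size (pm p) k'.
Proof.
elim: p k k' => [|c p IH] k k' kk' /=; first exact: kk'.
by apply: IH => -[|n] //=; rewrite /If -!kk'.
Qed.

Lemma Isnull_map p k k' :
  (forall b, fm (k b) = k' b) -> fm (Isnull p k) = Isnull (pm p) k'.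
Proof. by move=> kk'; apply: Size_map => n. Qed.

Lemma LtSize_map p q k k' : (forall b, fm (k b) = k' b) ->
  fm (LtSize p q k) = LtSize (pm p) (pm q) k'.
Proof. by move=> kk'; apply: Size_map => n; apply: Size_map => m. Qed.

Lemma LeadCoef_map p k k' : (forall t, fm (k t) = k' (tm t)) ->
  fm (LeadCoef p k) = LeadCoef (pm p) k'.
Proof.
elim: p k k' => [|c p IH] k k' kk' /=; first by rewrite /= kk' /= rmorph0.
by apply: IH => t /=; rewrite /If -!kk'.
Qed.

Lemma AmulXn_map a n : pm (AmulXn a n) = AmulXn (tm a) n.
Proof. by elim: n => //= n ->; rewrite rmorph0. Qed.

Lemma AddPoly_map p q : pm (AddPoly p q) = AddPoly (pm p) (pm q).
Proof. by elim: p q => //= a p IH [|b q] //=; rewrite IH. Qed.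

Lemma ScalPoly_map c p : pm (ScalPoly c p) = ScalPoly (tm c) (pm p).
Proof. by rewrite /pm /ScalPoly -!map_comp. Qed.

Lemma MulPoly_map p q : pm (MulPoly p q) = MulPoly (pm p) (pm q).
Proof. by elim: p => //= a p IH; rewrite AddPoly_map ScalPoly_map /= IH. Qed.

Lemma ExpPoly_map p n : pm (ExpPoly p n) = ExpPoly (pm p) n.
Proof.
rewrite /ExpPoly; case: n => //= n.
elim: n => //= n IH; by rewrite MulPoly_map IH.
Qed.

Lemma OppPoly_map p : pm (OppPoly p) = OppPoly (pm p).
Proof. by rewrite /OppPoly ScalPoly_map /= rmorphN1. Qed.

Lemma NatMulPoly_map n p : pm (NatMulPoly n p) = NatMulPoly n (pm p).
Proof. exact: ScalPoly_map. Qed.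

Lemma Deriv_map p : pm (Deriv p) = Deriv (pm p).
Proof. by elim: p => //= a p IH; rewrite AddPoly_map /= IH. Qed.

Lemma Rediv_rec_loop_map q sq cq c qq r n k k' :
  (forall c a b, fm (k (c, a, b)) = k' (c, pm a, pm b)) ->
  fm (Rediv_rec_loop q sq cq c qq r n k) =
  Rediv_rec_loop (pm q) sq (tm cq) c (pm qq) (pm r) n k'.
Proof.
move=> kk'; elim: n c qq r => [|n IH] c qq r /=.
  apply: Size_map => sr; case: ifP => _; first exact: kk'.
  apply: LeadCoef_map => lr.
  by rewrite kk' !(AddPoly_map, OppPoly_map, MulPoly_map, AmulXn_map).
apply: Size_map => sr; case: ifP => _; first exact: kk'.
apply: LeadCoef_map => lr.
by rewrite IH !(AddPoly_map, OppPoly_map, MulPoly_map, AmulXn_map).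
Qed.

Lemma Rediv_map p q k k' :
  (forall c a b, fm (k (c, a, b)) = k' (c, pm a, pm b)) ->
  fm (Rediv p q k) = Rediv (pm p) (pm q) k'.
Proof.
move=> kk'; apply: Isnull_map => b; case: b; first by rewrite kk' /= rmorph0.
apply: Size_map => sq; apply: Size_map => sp; apply: LeadCoef_map => lq.
by rewrite (Rediv_rec_loop_map _ _ _ _ _ _ _ kk') /= rmorph0.
Qed.

Lemma Rmod_map p q k k' : (forall r, fm (k r) = k' (pm r)) ->
  fm (Rmod p q k) = Rmod (pm p) (pm q) k'.
Proof. by move=> kk'; apply: Rediv_map => c a b. Qed.

Lemma Rscal_map p q k k' : (forall r, fm (k r) = k' r) ->
  fm (Rscal p q k) = Rscal (pm p) (pm q) k'.
Proof. by move=> kk'; apply: Rediv_map => c a b. Qed.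

Lemma Rgcd_loop_map n p q k k' : (forall r, fm (k r) = k' (pm r)) ->
  fm (Rgcd_loop n p q k) = Rgcd_loop n (pm p) (pm q) k'.
Proof.
move=> kk'; elim: n p q => [|n IH] p q /=; apply: Rmod_map => r;
  by apply: Isnull_map => -[].
Qed.

Lemma Rgcd_map p q k k' : (forall r, fm (k r) = k' (pm r)) ->
  fm (Rgcd p q k) = Rgcd (pm p) (pm q) k'.
Proof.
move=> kk'; apply: LtSize_map => -[]; apply: Isnull_map => -[] //;
by apply: Size_map => n; apply: Rgcd_loop_map.
Qed.

Lemma BigRgcd_map ps k k' : (forall r, fm (k r) = k' (pm r)) ->
  fm (BigRgcd ps k) = BigRgcd (psm ps) k'.
Proof.
elim: ps k k' => [|p ps IH] k k' kk' /=; first by rewrite kk' /= rmorph0.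
by apply: IH => r; apply: Rgcd_map.
Qed.

Lemma Changes_map s k k' : (forall n, fm (k n) = k' n) ->
  fm (Changes s k) = Changes (map tm s) k'.
Proof.
elim: s k k' => [|a s IH] k k' kk' //=.
apply: IH => n; rewrite /If /= !kk'.
by case: s.
Qed.

Lemma SeqPInfty_map ps k k' : (forall s, fm (k s) = k' (map tm s)) ->
  fm (SeqPInfty ps k) = SeqPInfty (psm ps) k'.
Proof.
elim: ps k k' => [|p ps IH] k k' kk' /=; first exact: kk'.
by apply: LeadCoef_map => lp; apply: IH => s; apply: kk'.
Qed.

Lemma SeqMInfty_map ps k k' : (forall s, fm (k s) = k' (map tm s)) ->
  fm (SeqMInfty ps k) = SeqMInfty (psm ps) k'.
Proof.
elim: ps k k' => [|p ps IH] k k' kk' /=; first exact: kk'.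
apply: LeadCoef_map => lp; apply: Size_map => sp; apply: IH => s.
by rewrite kk' /= rmorphN1.
Qed.

Lemma ChangesPoly_map ps k k' : (forall n, fm (k n) = k' n) ->
  fm (ChangesPoly ps k) = ChangesPoly (psm ps) k'.
Proof.
move=> kk'; apply: SeqMInfty_map => s; apply: SeqPInfty_map => s'.
by apply: Changes_map => n; apply: Changes_map => n'.
Qed.

Lemma NextMod_map p q k k' : (forall r, fm (k r) = k' (pm r)) ->
  fm (NextMod p q k) = NextMod (pm p) (pm q) k'.
Proof.
move=> kk'; apply: LeadCoef_map => lq; apply: Rscal_map => n.
by apply: Rmod_map => r; rewrite kk' ScalPoly_map.
Qed.

Lemma ModsAux_map p q n k k' : (forall s, fm (k s) = k' (psm s)) ->
  fm (ModsAux p q n k) = ModsAux (pm p) (pm q) n k'.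
Proof.
elim: n p q k k' => [|n IH] p q k k' kk' /=; first exact: kk'.
apply: Isnull_map => -[]; first exact: kk'.
by apply: NextMod_map => r; apply: IH => s; apply: kk'.
Qed.

Lemma Mods_map p q k k' : (forall s, fm (k s) = k' (psm s)) ->
  fm (Mods p q k) = Mods (pm p) (pm q) k'.
Proof.
by move=> kk'; apply: Size_map => n; apply: Size_map => m; apply: ModsAux_map.
Qed.

Lemma PolyComb_map sq sc : pm (PolyComb sq sc) = PolyComb (psm sq) sc.
Proof.
rewrite /PolyComb size_map; elim: (iota _ _) => //= i s IH.
rewrite MulPoly_map IH ExpPoly_map; congr (MulPoly (ExpPoly _ _) _).
have [ilt|ile] := ltnP i (size sq); first by rewrite (nth_map [::]).
by rewrite !nth_default ?size_map.
Qed.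

Lemma Pcq_map sq i : pm (Pcq sq i) = Pcq (psm sq) i.
Proof.
rewrite /Pcq size_map.
have [ilt|ile] := ltnP i (size (sg_tab (size sq))).
  by rewrite !(nth_map [::]) // PolyComb_map.
by rewrite [in LHS]nth_default ?[in RHS]nth_default ?size_map.
Qed.

Lemma TaqsR_map p sq i k k' : (forall t, fm (k t) = k' (tm t)) ->
  fm (TaqsR p sq i k) = TaqsR (pm p) (psm sq) i k'.
Proof.
move=> kk'; rewrite /TaqsR /TaqR /bind_def.
rewrite -Pcq_map -Deriv_map -MulPoly_map.
apply: Mods_map => s; apply: ChangesPoly_map => n.
by rewrite kk' /= rmorph_int.
Qed.

Lemma BoundingPoly_map sq : pm (BoundingPoly sq) = BoundingPoly (psm sq).
Proof.
rewrite /BoundingPoly Deriv_map; congr Deriv.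
by elim: sq => //= p s IH; rewrite MulPoly_map IH.
Qed.

(** These constants are entries of the inverse of an integer matrix, hence rational and preserved by
    [h]. *)
Lemma coefs_map n i : h (coefs K n i) = coefs L n i.
Proof.
rewrite /coefs.
have [ilt|ile] := ltnP i (expn 3 n); last first.
  by rewrite [in LHS]nth_default ?rmorph0 ?[in RHS]nth_default ?size_map -?enumT ?size_enum_ord.
rewrite !(nth_map (Ordinal ilt)) -?enumT ?size_enum_ord //.
have <- : map_mx h (invmx (map_mx (intmul 1) (ctmat n))) =
          invmx (map_mx (intmul 1) (ctmat n)).
  rewrite map_invmx -map_mx_comp; congr invmx; apply/matrixP => a b.
  by rewrite !mxE /= rmorph_int.
by rewrite !castmxE mxE.
Qed.

Lemma Coefs_map n i : tm (Coefs K n i) = Coefs L n i.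
Proof.
rewrite /tm /Coefs /=; congr Const.
case: n => [|[|n]]; first by rewrite rmorph_nat.
  have h2 : h 2^-1 = 2^-1 by rewrite fmorphV rmorph_nat.
  by case: i => [|[|[|i]]] /=; rewrite ?h2 ?rmorph0 ?nth_nil ?rmorph0.
exact: coefs_map.
Qed.

Lemma CcountWeak_map p sq k k' : (forall t, fm (k t) = k' (tm t)) ->
  fm (CcountWeak p sq k) = CcountWeak (pm p) (psm sq) k'.
Proof.
move=> kk'; rewrite /CcountWeak.
rewrite size_map.
(* The loop carries an accumulator, so its initial value 0 is generalized before the induction. *)
have -> : (0%qfT : term L) = tm 0%qfT by [].
move: (0%qfT : term K) => t0.
elim: (3 ^ size sq)%N t0 => [|n IH] s /=; first exact: kk'.
apply: TaqsR_map => x; rewrite /bind_def -Coefs_map; exact: IH.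
Qed.

Lemma CcountGt0_map sp sq : fm (CcountGt0 sp sq) = CcountGt0 (psm sp) (psm sq).
Proof.
apply: BigRgcd_map => p; apply: Isnull_map => -[] /=; last first.
  exact: CcountWeak_map.
rewrite -BoundingPoly_map; apply: CcountWeak_map => t /=.
congr (Or _ (Or _ _)).
  elim: sq => //= q s <-; congr And.
  exact: LeadCoef_map.
elim: sq => //= q s <-; congr And.
by apply: Size_map => n; apply: LeadCoef_map.
Qed.

Lemma abstrX_map i t : pm (abstrX i t) = abstrX i (tm t).
Proof.
elim: t => //=.
- by move=> n; case: ifP.
- by move=> a IHa b IHb; rewrite AddPoly_map IHa IHb.
- by move=> a IHa; rewrite OppPoly_map IHa.
- by move=> a IHa n; rewrite NatMulPoly_map IHa.
- by move=> a IHa b IHb; rewrite MulPoly_map IHa IHb.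
- by move=> a IHa n; rewrite ExpPoly_map IHa.
Qed.

End TermMap.

(** * Elimination of one existential quantifier *)

Definition clause_proj (K : realFieldType) i (c : seq (term K) * seq (term K)) :=
  CcountGt0 (map (abstrX i) c.1) (map (abstrX i) c.2).

Definition clause_map (K L : realFieldType) (h : {rmorphism K -> L})
  (c : seq (term K) * seq (term K)) :=
  (map (term_map h) c.1, map (term_map h) c.2).

Definition clause_eval (K : realFieldType) (e : seq K)
  (c : seq (term K) * seq (term K)) :=
  all (fun t => eval e t == 0) c.1 && all (fun t => 0 < eval e t) c.2.

Lemma clause_proj_map (K L : realFieldType) (h : {rmorphism K -> L}) i c :
  formula_map h (clause_proj i c) = clause_proj i (clause_map h c).
Proof.
rewrite /clause_proj CcountGt0_map -!map_comp.
by congr CcountGt0; apply: eq_map => t /=; rewrite abstrX_map.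
Qed.

Lemma clause_projP (F : rcfType) i c (e : seq F) :
  reflect (exists x, clause_eval (set_nth 0 e i x) c) (qf_eval e (clause_proj i c)).
Proof.
have E x (s : seq (term F)) (P : pred F) :
    all (fun t => P (eval (set_nth 0 e i x) t)) s =
    all (fun p : {poly F} => P p.[x]) (map (eval_poly e) (map (abstrX i) s)).
  by rewrite !all_map; apply: eq_all => t /=; rewrite abstrXP.
rewrite eval_CcountGt0; apply: (iffP (ccount_gt0P _ _)) => -[x Hx]; exists x; move: Hx.
  by rewrite !big_all /clause_eval (E x _ (eq_op^~ 0)) (E x _ (> 0)).
by rewrite !big_all /clause_eval (E x _ (eq_op^~ 0)) (E x _ (> 0)).
Qed.

(** The flag [b] is a polarity: [false] asks for the normal form of the negation. A clause is a list
    of terms required to vanish and a list of terms required to be positive. *)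
Fixpoint dnf (K : realFieldType) (b : bool) (f : formula K) :
    seq (seq (term K) * seq (term K)) :=
  let conj (s t : seq (seq (term K) * seq (term K))) :=
    [seq (c.1 ++ c'.1, c.2 ++ c'.2) | c <- s, c' <- t] in
  match f with
  | Bool v => if v == b then [:: ([::], [::])] else [::]
  | Equal t u => if b then [:: ([:: (t - u)%qfT], [::])]
      else [:: ([::], [:: (t - u)%qfT]); ([::], [:: (u - t)%qfT])]
  | Lt t u => if b then [:: ([::], [:: (u - t)%qfT])]
      else [:: ([:: (t - u)%qfT], [::]); ([::], [:: (t - u)%qfT])]
  | Le t u => if b then [:: ([:: (t - u)%qfT], [::]); ([::], [:: (u - t)%qfT])]
      else [:: ([::], [:: (t - u)%qfT])]
  | And f g => if b then conj (dnf b f) (dnf b g) else dnf b f ++ dnf b g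
  | Or f g => if b then dnf b f ++ dnf b g else conj (dnf b f) (dnf b g)
  | Implies f g => if b then dnf (~~ b) f ++ dnf b g else conj (dnf (~~ b) f) (dnf b g)
  | Not f => dnf (~~ b) f
  end.

Lemma dnfP (K : realFieldType) (e : seq K) b f :
  has (clause_eval e) (dnf b f) = (qf_eval e f == b).
Proof.
have conjP (s t : seq (seq (term K) * seq (term K))) :
    has (clause_eval e) [seq (c.1 ++ c'.1, c.2 ++ c'.2) | c <- s, c' <- t] =
    has (clause_eval e) s && has (clause_eval e) t.
  elim: s => //= c s IH; rewrite has_cat IH andb_orl; congr (_ || _).
  rewrite has_map; elim: t {IH} => [|c' t IH] /=; first by rewrite andbF.
  rewrite IH andb_orr; congr (_ || _); rewrite /clause_eval /= !all_cat.
  by rewrite andbACA.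
elim: f b => [v|t u|t u|t u|f IHf g IHg|f IHf g IHg|f IHf g IHg|f IHf] b /=.
- by case: v b => -[].
- case: b => /=; rewrite /clause_eval /= ?andbT ?orbF ?subr_eq0 ?eqb_id ?subr_gt0 //.
  by case: ltgtP.
- case: b => /=; rewrite /clause_eval /= ?andbT ?orbF ?subr_eq0 ?subr_gt0 ?eqb_id //.
  by case: ltgtP.
- case: b => /=; rewrite /clause_eval /= ?andbT ?orbF ?subr_eq0 ?subr_gt0 ?eqb_id //;
  by case: ltgtP.
- case: b; rewrite ?conjP ?has_cat IHf IHg; by case: (qf_eval _ _) (qf_eval _ _) => -[].
- case: b; rewrite ?conjP ?has_cat IHf IHg; by case: (qf_eval _ _) (qf_eval _ _) => -[].
- case: b; rewrite ?conjP ?has_cat IHf IHg; by case: (qf_eval _ _) (qf_eval _ _) => -[].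
- by rewrite IHf; case: (qf_eval _ _) b => -[].
Qed.

Lemma dnf_map (K L : realFieldType) (h : {rmorphism K -> L}) b f :
  dnf b (formula_map h f) = map (clause_map h) (dnf b f).
Proof.
have conj_map (s t : seq (seq (term K) * seq (term K))) :
    map (clause_map h) [seq (c.1 ++ c'.1, c.2 ++ c'.2) | c <- s, c' <- t] =
    [seq (c.1 ++ c'.1, c.2 ++ c'.2) | c <- map (clause_map h) s, c' <- map (clause_map h) t].
  elim: s => //= c s IH; rewrite map_cat IH; congr (_ ++ _).
  by rewrite -!map_comp; apply: eq_map => c' /=; rewrite /clause_map /= !map_cat.
elim: f b => [v|t u|t u|t u|f IHf g IHg|f IHf g IHg|f IHf g IHg|f IHf] [] /=;
  rewrite ?conj_map ?map_cat ?IHf ?IHg //; by case: v.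
Qed.

Definition formula_proj (K : realFieldType) i (f : formula K) : formula K :=
  foldr (fun c g => Or (clause_proj i c) g) (Bool false) (dnf true f).

Lemma formula_proj_map (K L : realFieldType) (h : {rmorphism K -> L}) i f :
  formula_map h (formula_proj i f) = formula_proj i (formula_map h f).
Proof.
rewrite /formula_proj dnf_map.
by elim: (dnf _ _) => //= c s ->; rewrite clause_proj_map.
Qed.

Lemma formula_projP (F : rcfType) i f (e : seq F) :
  reflect (exists x, qf_eval (set_nth 0 e i x) f) (qf_eval e (formula_proj i f)).
Proof.
apply: (@equivP (exists x, has (clause_eval (set_nth 0 e i x)) (dnf true f))); last first.
  by split=> -[x] H; exists x; move: H; rewrite dnfP eqb_id.
rewrite /formula_proj; elim: (dnf true f) => [|c s IH] /=; first by constructor; case.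
apply: (iffP orP) => [[/clause_projP[x cx]|/IH[x sx]]|[x /orP[cx|sx]]].
- by exists x; rewrite cx.
- by exists x; rewrite sx orbT.
- by left; apply/clause_projP; exists x.
- by right; apply/IH; exists x.
Qed.

(** * Predicates definable uniformly in the field *)

Definition definable n (P : forall F : rcfType, seq F -> Prop) :=
  exists f : formula rat, forall (F : rcfType) (e : seq F), size e = n ->
    P F e <-> qf_eval e (formula_map (ratr : {rmorphism rat -> F}) f).

Definition definable_fun n (t : forall F : rcfType, seq F -> F) :=
  exists u : term rat, forall (F : rcfType) (e : seq F), size e = n ->
    t F e = eval e (term_map (ratr : {rmorphism rat -> F}) u).

(** One rational formula serves all fields. In the empty environment its terms are rational numbers,
    and [ratr] preserves and reflects equality and order. *)
Lemma definable_sentence (P : forall F : rcfType, seq F -> Prop) :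
  definable 0 P -> forall F G : rcfType, P F [::] -> P G [::].
Proof.
move=> [f Pf].
have evalr (F : rcfType) (t : term rat) : eval ([::] : seq F)
    (term_map (ratr : {rmorphism rat -> F}) t) = ratr (eval ([::] : seq rat) t).
  elim: t => /= [i|c|n|t -> u ->|t ->|t -> n|t -> u ->|t -> n].
  - by rewrite !nth_nil rmorph0.
  - by [].
  - by rewrite rmorph_nat.
  - by rewrite rmorphD.
  - by rewrite rmorphN.
  - by rewrite rmorphMn.
  - by rewrite rmorphM.
  - by rewrite rmorphXn.
have qfr (F : rcfType) (g : formula rat) : qf_eval ([::] : seq F)
    (formula_map (ratr : {rmorphism rat -> F}) g) = qf_eval ([::] : seq rat) g.
  elim: g => /= [b|t u|t u|t u|g -> g' ->|g -> g' ->|g -> g' ->|g ->] //;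
  by rewrite !evalr ?(inj_eq (fmorph_inj _)) ?ltr_rat ?ler_rat.
by move=> F G /(Pf F [::] erefl); rewrite qfr => ?; apply/Pf; rewrite // qfr.
Qed.

Lemma definable_iff n (P Q : forall F : rcfType, seq F -> Prop) :
  (forall F e, size e = n -> P F e <-> Q F e) -> definable n P -> definable n Q.
Proof.
move=> PQ [f Pf]; exists f => F e en; rewrite -Pf //; symmetry; exact: PQ.
Qed.

Lemma definable_le n t u : definable_fun n t -> definable_fun n u ->
  definable n (fun F e => t F e <= u F e).
Proof.
by move=> [a ta] [b ub]; exists (Le a b) => F e en; rewrite /= ta // ub.
Qed.

Lemma definable_eq n t u : definable_fun n t -> definable_fun n u ->
  definable n (fun F e => t F e = u F e).
Proof.
by move=> [a ta] [b ub]; exists (Equal a b) => F e en; rewrite /= ta // ub //; split=> /eqP.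
Qed.

Lemma definable_not n P : definable n P -> definable n (fun F e => ~ P F e).
Proof.
move=> [f Pf]; exists (Not f) => F e en /=; rewrite Pf //; split => [?|/negP//].
exact/negP.
Qed.

Lemma definable_and n P Q : definable n P -> definable n Q ->
  definable n (fun F e => P F e /\ Q F e).
Proof.
move=> [f Pf] [g Qg]; exists (And f g) => F e en /=; rewrite Pf // Qg //.
exact: rwP andP.
Qed.

Lemma definable_true n : definable n (fun _ _ => Logic.True).
Proof. by exists (Bool true). Qed.

Lemma definable_forall_in n (J : finType) (A : {pred J})
    (P : J -> forall F : rcfType, seq F -> Prop) :
  (forall j, j \in A -> definable n (P j)) ->
  definable n (fun F e => forall j, j \in A -> P j F e).
Proof.
move=> Pj.
suff H (s : seq J) : definable n (fun F e => forall j, j \in s -> j \in A -> P j F e).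
  apply: (definable_iff _ (H (enum J))) => F e en.
  by split=> [h j|h j _]; [apply: h; rewrite mem_enum|apply: h].
elim: s => [|j s IH].
  by apply: (definable_iff _ (definable_true n)) => F e en; split.
have {}Pj : definable n (fun F e => j \in A -> P j F e).
  have [jA|jA] := boolP (j \in A); last first.
    by apply: (definable_iff _ (definable_true n)) => F e en; split.
  by apply: (definable_iff _ (Pj j jA)) => F e en; split=> //; apply.
apply: (definable_iff _ (definable_and Pj IH)) => F e en; split.
  by move=> [h1 h2] i; rewrite inE => /predU1P[->//|]; exact: h2.
by move=> h; split=> [|i si]; apply: h; rewrite inE ?eqxx ?si ?orbT.
Qed.

Lemma definable_forall n (J : finType) (P : J -> forall F : rcfType, seq F -> Prop) :
  (forall j, definable n (P j)) -> definable n (fun F e => forall j, P j F e).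
Proof.
move=> dP; have H := @definable_forall_in n J predT P (fun j _ => dP j).
by apply: (definable_iff _ H) => F e _; split=> h j //; exact: h.
Qed.

Lemma definable_implyb n (b : bool) (P : forall F : rcfType, seq F -> Prop) :
  definable n P -> definable n (fun F e => b -> P F e).
Proof.
case: b => dP; first by apply: (definable_iff _ dP) => F e _; split=> //; apply.
by apply: (definable_iff _ (definable_true n)) => F e _; split.
Qed.

Lemma definable_exists_in n (J : finType) (A : {pred J})
    (P : J -> forall F : rcfType, seq F -> Prop) :
  (forall j, j \in A -> definable n (P j)) ->
  definable n (fun F e => exists2 j, j \in A & P j F e).
Proof.
move=> Pj.
have H := definable_not (definable_forall_in (fun j jA => definable_not (Pj j jA))).
apply: definable_iff H => F e en; split=> [h|[j jA Pje] h]; last exact: h jA Pje.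
by apply: NNPP => h'; apply: h => j jA Pje; apply: h'; exists j.
Qed.

Lemma definable_fun_nth n i : definable_fun n (fun F e => e`_i).
Proof. by exists (Var _ i). Qed.

Lemma definable_fun_nat n c : definable_fun n (fun F e => c%:R).
Proof. by exists (NatConst _ c). Qed.

Lemma definable_fun_ext n (t u : forall F : rcfType, seq F -> F) :
  (forall F e, size e = n -> t F e = u F e) -> definable_fun n t -> definable_fun n u.
Proof. by move=> tu [a ta]; exists a => F e en; rewrite -tu // ta. Qed.

Lemma definable_funM n t u : definable_fun n t -> definable_fun n u ->
  definable_fun n (fun F e => t F e * u F e).
Proof. by move=> [a ta] [b ub]; exists (Mul a b) => F e en; rewrite /= ta // ub. Qed.

Lemma definable_fun_sum n (J : finType) (t : J -> forall F : rcfType, seq F -> F) :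
  (forall j, definable_fun n (t j)) -> definable_fun n (fun F e => \sum_j t j F e).
Proof.
move=> dt; suff H (s : seq J) : definable_fun n (fun F e => \sum_(j <- s) t j F e).
  by apply: definable_fun_ext (H (index_enum J)).
elim: s => [|j s IH].
  apply: definable_fun_ext (definable_fun_nat n 0) => F e _; by rewrite big_nil.
have [[a ta] [b sb]] := (dt j, IH).
by exists (Add a b) => F e en; rewrite big_cons /= ta // sb.
Qed.

(** This is where elimination enters. The environment has length [n], so variable [n] is the one
    appended at its end. *)
Lemma definable_exists1 n (P : forall F : rcfType, seq F -> Prop) :
  definable n.+1 P -> definable n (fun F e => exists x, P F (rcons e x)).
Proof.
move=> [f Pf]; exists (formula_proj n f) => F e en; rewrite formula_proj_map.
have E x : set_nth 0 e n x = rcons e x by elim: (e) (n) en => [|y s IH] [|k] //= [/IH->].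
split=> [[x Px]|/formula_projP[x]].
  by apply/formula_projP; exists x; rewrite E; apply/Pf; rewrite ?size_rcons ?en.
by rewrite E => Px; exists x; apply/Pf; rewrite ?size_rcons ?en.
Qed.

Lemma definable_exists_seq n k (P : forall F : rcfType, seq F -> Prop) :
  definable (n + k) P ->
  definable n (fun F e => exists2 w : seq F, size w = k & P F (e ++ w)).
Proof.
elim: k n => [|k IH] n.
  rewrite addn0; apply: definable_iff => F e en.
  split=> [Pe|[w /size0nil -> //]]; last by rewrite cats0.
  by exists [::]; rewrite ?cats0.
rewrite addnS -addSn => /IH/definable_exists1; apply: definable_iff => F e en.
split=> [[x [w wk]]|[[|x w] //= [wk]] Pw].
  by rewrite cat_rcons => Pw; exists (x :: w) => //=; rewrite wk.
by exists x, w; rewrite ?cat_rcons.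
Qed.

(** A function on [J] is a block of [#|J|] variables, appended in the order of [enum J]. *)
Lemma definable_exists_fun n (J : finType)
    (P : forall F : rcfType, seq F -> (J -> F) -> Prop) :
  definable (n + #|J|)
    (fun F e => P F (take n e) (fun j => e`_(n + enum_rank j))) ->
  definable n (fun F e => exists w : J -> F, P F e w).
Proof.
move=> /definable_exists_seq; apply: definable_iff => F e en.
split=> [[w wJ]|[w Pw]].
  rewrite take_size_cat // => Pw.
  by eexists; exact: Pw.
exists [seq w j | j <- enum J]; first by rewrite size_map cardE.
rewrite take_size_cat //; set w' := (X in P F e X); suff -> : w' = w by [].
apply: functional_extensionality => j; rewrite /w' nth_cat -en ltnNge leq_addr /=.
rewrite addKn (nth_map j) ?nth_enum_rank // -cardE; exact: ltn_ord.
Qed.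

Lemma definable_forall_fun n (J : finType)
    (P : forall F : rcfType, seq F -> (J -> F) -> Prop) :
  definable (n + #|J|)
    (fun F e => P F (take n e) (fun j => e`_(n + enum_rank j))) ->
  definable n (fun F e => forall w : J -> F, P F e w).
Proof.
move=> /definable_not dP.
have /definable_not := @definable_exists_fun n J (fun F e w => ~ P F e w) dP.
apply: definable_iff => F e en; split=> [h w|h [w]]; last by apply; exact: h.
by apply: NNPP => h'; apply: h; exists w.
Qed.

(** The positions [v] of the vertices are quantified as well, so no parameter remains. The point and
    the frame are packed into one function to form one block of variables. *)
Definition transversal_sentence (E : finType) (I : finType) (m d : nat)
    (fam : I -> {set {set E}}) (F : rcfType) : Prop :=
  forall v : E * 'I_d -> F, exists pU : 'I_d + 'I_m * 'I_d -> F,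
    let p a := pU (inl a) in let U l a := pU (inr (l, a)) in
    [/\ forall l, ~ (\sum_a U l a * U l a = 0),
        forall l l', l != l' -> \sum_a U l a * U l' a = 0 &
        forall (lam : 'I_m -> F) i, exists2 T, T \in fam i &
          forall e, e \in T -> \sum_a p a * (\sum_l lam l * U l a) <=
                               \sum_a v (e, a) * (\sum_l lam l * U l a)].

Lemma transversal_sentence_transfer (E I : finType) (m d : nat)
    (fam : I -> {set {set E}}) (F G : rcfType) :
  transversal_sentence m d fam F -> transversal_sentence m d fam G.
Proof.
pose P (K : rcfType) (e : seq K) := transversal_sentence m d fam K.
suff : definable 0 P by move=> /definable_sentence/(_ F G).
apply: definable_forall_fun; apply: definable_exists_fun.
set n1 := (0 + _)%N; set n2 := (n1 + _)%N.
(* The environment is [v], then the point and frame, then [lam]; nested [take] operations recover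
   the earlier blocks. *)
have dv n a b i : definable_fun n (fun K e => (take a (take b e))`_i).
  have [ia|ia] := ltnP i a; last first.
    apply: definable_fun_ext (definable_fun_nat n 0) => K e _.
    by rewrite nth_default // size_take_min geq_min ia.
  have [ib|ib] := ltnP i b; last first.
    apply: definable_fun_ext (definable_fun_nat n 0) => K e _.
    by rewrite nth_take // nth_default // size_take_min geq_min ib.
  by apply: definable_fun_ext (definable_fun_nth n i) => K e _; rewrite !nth_take.
have dv1 n b i : definable_fun n (fun K e => (take b e)`_i).
  have [ib|ib] := ltnP i b; last first.
    apply: definable_fun_ext (definable_fun_nat n 0) => K e _.
    by rewrite nth_default // size_take_min geq_min ib.
  by apply: definable_fun_ext (definable_fun_nth n i) => K e _; rewrite !nth_take.
have D3 n (A B C : forall K : rcfType, seq K -> Prop) :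
    definable n A -> definable n B -> definable n C ->
    definable n (fun K e => [/\ A K e, B K e & C K e]).
  move=> dA dB dC; apply: definable_iff (definable_and dA (definable_and dB dC)).
  by move=> K e _; split=> [[? []]|[]].
apply: D3.
- apply: definable_forall => l; apply: definable_not.
  apply: definable_eq; last exact: (definable_fun_nat _ 0).
  by apply: definable_fun_sum => a; apply: definable_funM; exact: definable_fun_nth.
- apply: definable_forall => l; apply: definable_forall => l'; apply: definable_implyb.
  apply: definable_eq; last exact: (definable_fun_nat _ 0).
  by apply: definable_fun_sum => a; apply: definable_funM; exact: definable_fun_nth.
apply: definable_forall_fun; apply: definable_forall => i.
apply: definable_exists_in => T _; apply: definable_forall_in => e _.
have dl a : definable_fun (n2 + #|'I_m|)
   (fun K (u : seq K) => \sum_l u`_(n2 + enum_rank l) *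
       (take n2 u)`_(n1 + enum_rank (inr (l, a) : 'I_d + 'I_m * 'I_d))).
  apply: definable_fun_sum => l; apply: definable_funM => //.
  exact: definable_fun_nth.
apply: definable_le; apply: definable_fun_sum => a; apply: definable_funM; try exact: dl.
  exact: dv1.
exact: dv.
Qed.

End Transfer.

(** * A discrete antipodal theorem on products of spheres *)

Lemma addF2 (x : 'F_2) : x + x = 0.
Proof. by apply/val_inj; case: x => [[|[|]]]. Qed.

Lemma F2_cases (x : 'F_2) : x = 0 \/ x = 1.
Proof. by case: x => [[|[|]]] //= ?; [left|right]; apply/val_inj. Qed.

Ltac F2_decide :=
  repeat (let a := fresh "a" in move=> a; case: (F2_cases a) => ->);
  exact/val_inj.

(** Comparing ranks in the enumeration picks one element of each orbit [{x, h x}]; the two equal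
    terms cancel in characteristic 2. *)
Lemma sum_involution (J : finType) (P : pred J) (F : J -> 'F_2) (h : J -> J) :
  (forall x, P x -> [/\ P (h x), h (h x) = x, h x != x & F (h x) = F x]) ->
  \sum_(x | P x) F x = 0.
Proof.
move=> H; rewrite (bigID (fun x => enum_rank x < enum_rank (h x))%N) /=.
rewrite [X in _ + X](reindex_onto h h) => [|x /andP[/H[]]//].
rewrite [X in _ + X](eq_big (fun x => P x && (enum_rank x < enum_rank (h x))%N) F).
- exact: addF2.
- move=> x; apply/idP/idP => [/andP[/andP[Phx] ] lt /eqP hh|/andP[Px lt]].
    have [Px _ ne _] := H _ Phx; rewrite hh in Px ne lt; rewrite Px /=.
    by move: lt; rewrite -leqNgt leq_eqVlt (inj_eq val_inj) (inj_eq enum_rank_inj) (negPf ne).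
  have [Phx hh _ _] := H _ Px; rewrite Phx hh eqxx andbT -leqNgt; exact: ltnW.
- by move=> x /andP[/andP[Phx _] /eqP hh]; have [_ _ _] := H _ Phx; rewrite hh.
Qed.

(** * Cells, faces and coboundaries *)

Section Grid.
Variables (n m d K : nat).
Hypotheses (nmd : (n + m <= d)%N) (K_gt0 : (0 < K)%N).

Notation I := ('I_m * 'I_d)%type.
Notation coord := 'I_(4 * K).+1.
Notation cell := {ffun I -> coord}.
Implicit Types (x v w : cell) (c q : I) (j : coord) (l : 'I_m) (b : bool) (f g : cell -> 'F_2).

(* Coordinates are doubled and shifted: an even value is a lattice point, an odd value an open unit
   interval, and [2 * K] is the origin. A cell of the product of the boundaries of [m] cubes is an
   [x] such that every block [l] has a coordinate [0] or [4 * K]. *)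
Definition upd x c j : cell := [ffun i => if i == c then j else x i].
Definition mv b j : coord := inord (if b then j.+1 else j.-1).
Definition face w c b := upd w c (mv b (w c)).
(** The mod 2 cellular coboundary: the odd coordinates are the directions in which [w] extends, and
    each gives two facets. *)
Definition cobdry f w := \sum_(c | odd (w c)) \sum_(b : bool) f (face w c b).

Lemma mv_val b j : odd j -> mv b j = (if b then j.+1 else j.-1) :> nat.
Proof. by move=> oj; rewrite inordK //; case: b; have := ltn_ord j; lia. Qed.

Lemma odd_mv b j : odd j -> odd (mv b j) = false.
Proof. by move=> oj; rewrite mv_val //; case: b; lia. Qed.

Lemma eq_cobdry f g w : (forall c b, odd (w c) -> f (face w c b) = g (face w c b)) ->
  cobdry f w = cobdry g w.
Proof. by move=> fg; apply: eq_bigr => c oc; apply: eq_bigr => b _; exact: fg. Qed.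

Lemma cobdryD f g w : cobdry (fun x => f x + g x) w = cobdry f w + cobdry g w.
Proof.
rewrite /cobdry -big_split; apply: eq_bigr => c _ /=; by rewrite -big_split.
Qed.

Lemma cobdryZ (a : 'F_2) f w : cobdry (fun x => a * f x) w = a * cobdry f w.
Proof.
by rewrite /cobdry mulr_sumr; apply: eq_bigr => c _; rewrite mulr_sumr.
Qed.

(** A face of codimension two is reached through its two directions in either order. *)
Lemma cobdry_cobdry f w : cobdry (cobdry f) w = 0.
Proof.
rewrite /cobdry; transitivity (\sum_(p : I * bool * (I * bool) |
   [&& odd (w p.1.1), p.2.1 != p.1.1 & odd (w p.2.1)])
     f (face (face w p.1.1 p.1.2) p.2.1 p.2.2)).
  rewrite pair_big_dep /=.
  under eq_bigr => p _ do rewrite pair_big_dep /=.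
  rewrite pair_big_dep /=; apply: eq_bigl => -[[c b] [c' b']] /=; rewrite !andbT ffunE.
  by case: (boolP (odd (w c))) => //= oc; case: eqP => [->|] //; rewrite odd_mv.
apply: (sum_involution (h := fun p => (p.2, p.1))) => -[[c b] [c' b']] /= /and3P[oc ne oc'].
split=> //; first by rewrite oc oc' eq_sym ne.
  by apply: contraNneq ne => -[->].
congr f; apply/ffunP => i; rewrite !ffunE (eq_sym c c') (negPf ne).
by case: (i =P c) => [->|//]; rewrite eq_sym (negPf ne).
Qed.

Definition extreme j := (j == 0%N :> nat) || (j == (4 * K)%N :> nat).
Definition onsphere x := [forall l, exists a, extreme (x (l, a))].

Lemma extreme_even j : extreme j -> ~~ odd j.
Proof. by rewrite /extreme => /orP[] /eqP ->; lia. Qed.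

(** The face relation between closed cells. *)
Definition below v w := forall i, v i = w i \/
  [/\ odd (w i), ~~ odd (v i) & (v i = (w i).+1 :> nat \/ w i = (v i).+1 :> nat)].

Lemma below_refl w : below w w. Proof. by left. Qed.

Lemma below_face v w c b : odd (w c) -> below v (face w c b) -> below v w.
Proof.
move=> oc H i; have := H i; rewrite ffunE; case: eqP => [->|_ //].
have om := odd_mv b oc; case=> [->|]; last by rewrite om; case.
right; rewrite om; split=> //; rewrite mv_val //.
case: b {H om}; first by left.
by right; case: (w c) oc => -[].
Qed.

Lemma face_onsphere w c b : odd (w c) -> onsphere w -> onsphere (face w c b).
Proof.
move=> oc /forallP H; apply/forallP => l; have /existsP[a ea] := H l.
apply/existsP; exists a; rewrite ffunE; case: eqP => // E.
by move: (extreme_even ea); rewrite E oc.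
Qed.

(** The antipode of the [l]-th sphere. *)
Definition flip l x : cell := [ffun i => if i.1 == l then rev_ord (x i) else x i].

Lemma flipE l x i : flip l x i = if i.1 == l then rev_ord (x i) else x i.
Proof. exact: ffunE. Qed.

Lemma odd_rev j : odd (rev_ord j) = odd j.
Proof. by rewrite /=; have := ltn_ord j; lia. Qed.

Lemma face_flip l w c b : odd (w c) ->
  face (flip l w) c b = flip l (face w c (b (+) (c.1 == l))).
Proof.
move=> oc; apply/ffunP => i; rewrite !ffunE.
case: (i =P c) => [->|//].
case: (c.1 =P l) => _; last by rewrite addbF.
apply/val_inj; rewrite /= !mv_val ?odd_rev //=.
by case: b => /=; have := ltn_ord (w c); lia.
Qed.

Lemma cobdry_flip l f g w :
  (forall x, onsphere x -> f (flip l x) = g x) -> onsphere w ->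
  cobdry f (flip l w) = cobdry g w.
Proof.
move=> fg Xw; rewrite /cobdry.
apply: eq_big => [c|c]; first by rewrite ffunE; case: ifP; rewrite ?odd_rev.
rewrite ffunE => oc; have {}oc : odd (w c) by move: oc; case: ifP; rewrite ?odd_rev.
(* In the directions of block [l] the antipode exchanges the two facets. *)
rewrite (reindex_inj (@addIb (c.1 == l))); apply: eq_bigr => b _.
by rewrite face_flip // -addbA addbb addbF fg // face_onsphere.
Qed.

(** * Invariant cochains and chains of sign changes *)

Definition invariant f := forall l x, onsphere x -> f (flip l x) = f x.

Lemma cobdry_invariant f : invariant f -> invariant (cobdry f).
Proof. by move=> If l x Xx; apply: cobdry_flip => // y Xy; exact: If. Qed.

(** The unit cochain, equal to 1 on every lattice point. *)
Definition init x : 'F_2 := [forall c, ~~ odd (x c)]%:R.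

(* Evaluated on a cell, [chain_rev sg s] counts modulo 2 the flags ending there along which the
   signs [sg q], [q] in [s], change successively: the cup product of the classes of the [sg q]. *)
Fixpoint chain_rev (sg : I -> cell -> 'F_2) (s : seq I) : cell -> 'F_2 :=
  if s is q :: s' then cobdry (fun x => sg q x * chain_rev sg s' x) else init.
Definition chain sg s := chain_rev sg (rev s).

Lemma chain_rcons sg s q :
  chain sg (rcons s q) = cobdry (fun x => sg q x * chain sg s x).
Proof. by rewrite /chain rev_rcons. Qed.

Lemma chain_cocycle sg s w : cobdry (chain sg s) w = 0.
Proof.
case/lastP: s => [|s q]; last by rewrite chain_rcons cobdry_cobdry.
apply: big1 => c oc; rewrite big_bool /=; set a := chain _ _ _; set b := chain _ _ _.
suff -> : a = b by exact: addF2.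
congr (_%:R); congr nat_of_bool; apply: eq_forallb => i; rewrite !ffunE.
by case: eqP => // _; rewrite !odd_mv.
Qed.

(** Because the chain is a cocycle, the constant [sg q w] can be added to the sign. Only facets
    whose sign differs from that of [w] then contribute. *)
Lemma chain_rconsE sg s q w : chain sg (rcons s q) w =
  cobdry (fun x => (sg q x + sg q w) * chain sg s x) w.
Proof.
rewrite chain_rcons -[LHS]addr0 -(mulr0 (sg q w)) -(chain_cocycle sg s w) -cobdryZ -cobdryD.
by apply: eq_cobdry => c b _; rewrite mulrDl.
Qed.

Lemma cobdry_neq0 f w : cobdry f w != 0 -> exists c b, odd (w c) /\ f (face w c b) != 0.
Proof.
move=> nz; have [/existsP[c /existsP[b /andP[oc fc]]]|H] :=
  boolP [exists c, exists b, odd (w c) && (f (face w c b) != 0)].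
  by exists c, b.
move/negP: nz; case; apply/eqP; apply: big1 => c oc; apply: big1 => b _.
apply/eqP; apply: contraNT H => fc.
by apply/existsP; exists c; apply/existsP; exists b; rewrite oc.
Qed.

(** A nonzero value leaves at least one flag. Each sign changes at its own step of the flag, and all
    members of the flag are faces of [w]. *)
Lemma chain_flag sg s w : chain sg s w != 0 -> onsphere w ->
  forall q, q \in s -> exists v v', [/\ below v w, below v' w,
    onsphere v, onsphere v' & sg q v != sg q v'].
Proof.
elim/last_ind: s w => [//|s q IH] w; rewrite chain_rconsE => /cobdry_neq0[c [b [oc]]].
rewrite mulf_eq0 negb_or => /andP[sgne /IH{}IH] Xw q'.
have Xf := face_onsphere b oc Xw; rewrite mem_rcons inE => /predU1P[->|].
  exists (face w c b), w; split=> //; try exact: below_refl.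
    exact: below_face oc (below_refl _).
  by apply: contraNneq sgne => ->; rewrite addF2.
move=> /(IH Xf)[v [v' [B B' X1 X2 ne]]]; exists v, v'.
by split=> //; exact: (below_face oc).
Qed.

Definition equivariant (chi : I -> 'I_m -> 'F_2) (sg : I -> cell -> 'F_2) (s : seq I) :=
  forall q l x, q \in s -> onsphere x -> sg q (flip l x) = sg q x + chi q l.

(** An antipode adds a constant to the last sign, which adds a multiple of the coboundary of a
    cocycle to the chain. *)
Lemma chain_invariant chi sg s : equivariant chi sg s -> invariant (chain sg s).
Proof.
elim/last_ind: s => [|s q IH] E.
  move=> l x _; congr (_%:R); congr nat_of_bool; apply: eq_forallb => i; rewrite ffunE.
  by case: ifP; rewrite ?odd_rev.
have {}IH : invariant (chain sg s).
  by apply: IH => q' l x q's; apply: E; rewrite mem_rcons inE q's orbT.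
move=> l x Xx; rewrite chain_rcons.
rewrite (@cobdry_flip l _ (fun y => sg q y * chain sg s y + chi q l * chain sg s y)) //.
  by rewrite cobdryD cobdryZ chain_cocycle mulr0 addr0.
by move=> y Xy; rewrite E ?IH // ?mem_rcons ?mem_head // mulrDl.
Qed.

(** Cohomologous in the quotient by the antipodes: [b] must be invariant for its coboundary to sum
    to 0 over a fundamental domain. *)
Definition cobordant f g :=
  exists2 b, invariant b & forall w, onsphere w -> f w + g w = cobdry b w.

(* Cup product with the class of the character [chi] does not depend on the sign function
   representing it. *)
Lemma chain_cobordant chi sg tau s : equivariant chi sg s -> equivariant chi tau s ->
  cobordant (chain sg s) (chain tau s).
Proof.
elim/last_ind: s => [|s q IH] Es Et.
  exists (fun=> 0) => [//|w _]; rewrite addF2; symmetry.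
  by apply: big1 => c _; apply: big1.
have sub chi' : equivariant chi chi' (rcons s q) -> equivariant chi chi' s.
  by move=> E q' l x q's; apply: E; rewrite mem_rcons inE q's orbT.
have [b Ib fg] := IH (sub _ Es) (sub _ Et).
have qs : q \in rcons s q by rewrite mem_rcons mem_head.
(* The first two terms already have the right coboundary, but an antipode changes the second by
   [chi q l * cobdry b]. The last term is a cocycle that changes by the same amount. *)
exists (fun w => (sg q w + tau q w) * chain sg s w + tau q w * cobdry b w
   + cobdry (fun x => tau q x * b x) w).
  move=> l x Xx.
  rewrite !Es ?Et // (chain_invariant (sub _ Es)) // (cobdry_invariant Ib) //.
  rewrite (@cobdry_flip l _ (fun y => tau q y * b y + chi q l * b y)) //; last first.
    by move=> y Xy; rewrite Et // Ib // mulrDl.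
  rewrite cobdryD cobdryZ.
  move: (sg q x) (tau q x) (chi q l) (chain _ _ _) (cobdry b x) (cobdry (fun y => tau q y * b y) x).
  by F2_decide.
move=> w Xw; rewrite !chain_rcons -cobdryD !cobdryD cobdry_cobdry addr0 -cobdryD -cobdryD.
apply: eq_cobdry => c b' oc.
rewrite -fg ?face_onsphere //.
by move: (sg _ _) (tau _ _) (chain sg _ _) (chain tau _ _); F2_decide.
Qed.

(** The coordinates not frozen at the origin. Removing the equation [(l, a)] freezes coordinate [a]
    of block [l]; coordinate [n + l] always stays, so with all equations present block [l] has
    [n + l + 1] live coordinates. *)
Definition live (s : seq I) c := (c \in s) || (c.2 == n + c.1 :> nat)%N.

(* For [s = equations] these are the top cells in a fundamental domain of the antipodes: the only
   even coordinate of each block is [4 * K]. For [s = [::]] only one vertex is left. *)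
Definition slice (s : seq I) x := [forall l, exists f : 'I_d,
  [&& live s (l, f), x (l, f) == (4 * K)%N :> nat &
    [forall a, (a != f) ==>
      (if live s (l, a) then odd (x (l, a)) else x (l, a) == (2 * K)%N :> nat)]]].

Lemma sliceP s x : reflect (forall l, exists f : 'I_d,
    [/\ live s (l, f), x (l, f) = (4 * K)%N :> nat & forall a, a != f ->
      if live s (l, a) then odd (x (l, a)) : Prop else x (l, a) = (2 * K)%N :> nat])
  (slice s x).
Proof.
apply: (iffP forallP) => H l.
  have /existsP[f /and3P[lf /eqP xf /forallP xa]] := H l; exists f; split=> // a af.
  by have := xa a; rewrite af /=; case: ifP => // _ /eqP.
have [f [lf xf xa]] := H l; apply/existsP; exists f; rewrite lf xf eqxx /=.
by apply/forallP => a; apply/implyP => af; have := xa _ af; case: ifP => // _ ->.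
Qed.

Lemma slice_onsphere s x : slice s x -> onsphere x.
Proof.
move=> /sliceP H; apply/forallP => l; have [f [_ xf _]] := H l.
by apply/existsP; exists f; rewrite /extreme xf eqxx orbT.
Qed.

Lemma slice_pole s x c : slice s x -> exists f : I,
  [/\ f.1 = c.1, live s f, x f = (4 * K)%N :> nat &
   forall i : I, i.1 = c.1 -> i != f ->
     x i <> (4 * K)%N :> nat /\
     if live s i then odd (x i) : Prop else x i = (2 * K)%N :> nat].
Proof.
move=> /sliceP/(_ c.1)[f [lf xf xa]]; exists (c.1, f); split=> // -[l a] /= -> ne.
have af : a != f by apply: contraNneq ne => ->.
split; last exact: xa.
have := xa a af; case: ifP => _.   by move=> + E; rewrite E oddM.
by move=> ->; lia.
Qed.

Definition pole x c : I := odflt c [pick f | (f.1 == c.1) && (x f == (4 * K)%N :> nat)].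

Lemma poleE s x c (f : I) : slice s x -> f.1 = c.1 -> x f = (4 * K)%N :> nat -> pole x c = f.
Proof.
move=> sx fc xf; have [g [gc _ xg H]] := slice_pole c sx.
have E i : i.1 = c.1 -> x i = (4 * K)%N :> nat -> i = g.
  by move=> ic xi; apply/eqP; apply/negPn/negP => ne; have [] := H i ic ne.
rewrite /pole; case: pickP => [i /andP[/eqP ic /eqP xi]|/(_ f)] /=.
  by rewrite (E _ ic xi) (E _ fc xf).
by rewrite fc xf !eqxx.
Qed.

(* The other top cell containing the face of [w] in direction [(c, b)], moved back by an
   antipode when that face lies on a second face [x c = 0 or 4 K] of the cube. *)
Definition coface (p : cell * I * bool) : cell * I * bool :=
  let: (w, c, b) := p in
  if extreme (mv b (w c)) then
    let f := pole w c in
    ([ffun i => if i == c then w f else if i == f then w c else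
        if (i.1 == c.1) && ~~ b then rev_ord (w i) else w i], f, b)
  else (upd w c (inord (if b then (w c).+2 else (w c).-2)), c, ~~ b).

(** The fundamental domain has no boundary modulo antipodes: [coface] pairs the incidences of cells
    and facets, and the two facets of a pair agree up to an antipode, which does not change [f]. *)
Lemma sum_slice_cobdry s f : invariant f -> \sum_(w | slice s w) cobdry f w = 0.
Proof.
move=> If; rewrite /cobdry.
transitivity (\sum_(p : cell * I * bool | slice s p.1.1 && odd (p.1.1 p.1.2))
    f (face p.1.1 p.1.2 p.2)).
  rewrite pair_big_dep /= pair_big_dep /=.
  by apply: eq_bigl => -[[w c] b] /=; rewrite andbT.
apply: (sum_involution (h := coface)) => -[[w c] b] /= /andP[sw oc].
have [p [pc lp wp H]] := slice_pole c sw.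
have poleE' := poleE sw pc wp.
have cp : c != p by apply: contraTneq oc => ->; rewrite wp; lia.
have [_ Hc] := H c erefl cp.
have lc : live s c by move: Hc; case: ifP => // _ Hc; move: oc; rewrite Hc; lia.
have mvc := mv_val b oc.
have wlt := ltn_ord (w c).
(* If the facet is not on a second face of the cube, the other cell lies just across it. *)
case: ifP => ex; last first.
  have bnd : if b then ((w c).+2 < 4 * K)%N else (2 < w c)%N.
    move/negbT: ex; rewrite /extreme negb_or mvc => /andP[/eqP e1 /eqP e2].
    move: oc wlt e1 e2; clear -K_gt0; move: (nat_of_ord _) => j.
    by case: b => /=; lia.
  have wc' : (inord (if b then (w c).+2 else (w c).-2) : coord) =
             (if b then (w c).+2 else (w c).-2) :> nat.
    rewrite inordK //; move: wlt bnd; clear; move: (nat_of_ord _) => j.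
    by case: b => /=; lia.
  set j := inord _ in wc' *.
  have oj : odd j.
    by rewrite wc'; move: oc bnd; clear; move: (nat_of_ord _) => i; case: b => /=; lia.
  have mj : mv (~~ b) j = mv b (w c).
    apply/val_inj; rewrite /= !mv_val // wc'.
    by move: oc bnd; clear; move: (nat_of_ord _) => i; case: b => /=; lia.
  split=> /=.
  - rewrite ffunE eqxx oj andbT; apply/sliceP => l.
    have /sliceP/(_ l)[g [lg wg Hg]] := sw.
    have cg : (l, g) != c by apply: contraTneq oc => <-; rewrite wg oddM.
    exists g; rewrite ffunE (negPf cg); split=> // a ag; rewrite ffunE.
    by case: eqP => [->|_]; [rewrite lc|exact: Hg].
  - rewrite ffunE eqxx mj ex negbK; congr (_, _, _); apply/ffunP => i; rewrite !ffunE.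
    case: eqP => [->|//]; apply/val_inj; rewrite /= wc' inordK; move: oc bnd wlt;
    by clear; move: (nat_of_ord _) => k; case: b => /=; lia.
  - by apply/eqP => -[_ bb]; case: (b) bb.
  - congr f; apply/ffunP => i; rewrite !ffunE; case: eqP => // _.
    by rewrite eqxx mj.
(* Otherwise the neighbour has its pole at [c], and the old pole [p] becomes an open coordinate. *)
rewrite poleE' /=.
have pvc : (p == c) = false by rewrite eq_sym (negPf cp).
set w' : cell := [ffun i => _].
have w'c : w' c = w p by rewrite ffunE eqxx.
have w'p : w' p = w c by rewrite ffunE pvc eqxx.
have sw' : slice s w'.
  apply/sliceP => l; have [lc1|lc1] := eqVneq l c.1.
    exists c.2; rewrite lc1 -surjective_pairing w'c; split=> // a ac.
    have ic : (c.1, a) != c by apply: contraNneq ac => <-.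
    rewrite ffunE (negPf ic) /=; case: eqP => [->|/eqP ip]; first by rewrite lp.
    have [_] := H (c.1, a) erefl ip; rewrite eqxx /=.
    case: (live _ _); case: (b) => //=; first by rewrite odd_rev.
    by lia.
  have /sliceP/(_ l)[g [lg wg Hg]] := sw.
  have E a : w' (l, a) = w (l, a).
    rewrite ffunE; case: eqP => [e|_]; first by rewrite -e eqxx in lc1.
    case: eqP => [e|_]; first by rewrite -pc -e eqxx in lc1.
    by rewrite /= (negPf lc1).
  by exists g; rewrite E; split=> // a ag; rewrite E; exact: Hg.
have pole' : pole w' p = c by apply: poleE sw' _ _; rewrite ?w'c.
split=> /=.
- by rewrite sw' w'p oc.
- rewrite w'p ex pole'; congr (_, _, _); apply/ffunP => i; rewrite ffunE w'c.
  case: eqP => [->//|/eqP ip]; case: eqP => [->//|/eqP ic].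
  rewrite ffunE (negPf ip) (negPf ic) pc.
  by case: ((i.1 == c.1) && ~~ b) => //; rewrite rev_ordK.
- by rewrite !xpair_eqE pvc andbF.
(* At [4 * K] the two facets are equal. At 0 they are exchanged by the antipode of the block of [c],
   and the invariance of [f] is needed. *)
have [mv4|mv0] : b /\ mv b (w c) = w p \/ ~~ b /\ mv b (w c) = rev_ord (w p).
  move: ex; rewrite /extreme mvc => /orP[] /eqP e.
    right; case: (b) e mvc => // e mvc; split=> //.
    by apply/val_inj => /=; rewrite mvc e wp subSS subnn.
  left; case: (b) e mvc => /= e mvc; first by split=> //; apply/val_inj; rewrite /= mvc e wp.
  by move: e wlt; clear -K_gt0; move: (nat_of_ord _) => j; lia.
- case: mv4 => bt mv4; congr f; apply/ffunP => i; rewrite [LHS]ffunE [RHS]ffunE w'p mv4.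
  case: (i =P p) => [->|/eqP ip]; first by rewrite pvc.
  rewrite ffunE (negPf ip) bt andbF; by case: eqP => // ->.
case: mv0 => bf mv0; rewrite -[RHS](If c.1) ?face_onsphere ?(slice_onsphere sw) //.
congr f; apply/ffunP => i; rewrite [LHS]ffunE [RHS]flipE [in RHS]ffunE w'p mv0.
case: (i =P p) => [->|/eqP ip]; first by rewrite pc eqxx pvc.
rewrite ffunE (negPf ip) bf andbT.
by case: (i =P c) => [->|//]; rewrite eqxx rev_ordK.
Qed.

(** * A model with a single surviving flag *)

Lemma last_subproof l : (n + l < d)%N.
Proof. by apply: leq_trans nmd; rewrite ltn_add2l. Qed.
Definition last_coord l : I := (l, Ordinal (last_subproof l)).

Definition neg j := (j < 2 * K)%N.

(** An odd sign defined on the whole sphere of block [k], used to break ties. The choice of the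
    extreme coordinate depends only on which coordinates are extreme, and antipodes preserve
    this. *)
Definition pole_sign (k : nat) x : bool :=
  if [pick c : I | (c.1 == k :> nat) && extreme (x c)] is Some c
  then x c == 0%N :> nat else false.

Lemma rev_val j : rev_ord j = (4 * K - j)%N :> nat.
Proof. by rewrite /= subSS. Qed.

Lemma pole_sign_flip k l x : (k < m)%N -> onsphere x ->
  pole_sign k (flip l x) = pole_sign k x (+) (l == k :> nat).
Proof.
move=> km /forallP Xx; rewrite /pole_sign.
have ext c : extreme (flip l x c) = extreme (x c).
  rewrite flipE; case: ifP => // _; rewrite /extreme /= subSS.
  by have := ltn_ord (x c); move: (nat_of_ord (x c)) => j; lia.
rewrite (@eq_pick _ _ (fun c : I => (c.1 == k :> nat) && extreme (x c))); last first.
  by move=> c; rewrite /= ext.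
case: pickP => [c /andP[/eqP ck ec]|H]; last first.
  have /existsP[a ea] := Xx (Ordinal km).
  by have := H (Ordinal km, a); rewrite /= eqxx ea.
have -> : (l == k :> nat) = (c.1 == l) by rewrite -ck eq_sym.
rewrite flipE; case: (c.1 == l); last by rewrite addbF.
move: ec; rewrite /extreme /= subSS; move: (nat_of_ord _) => j.
by rewrite addbT; lia.
Qed.

(** The sign of coordinate [q] plus an infinitesimal positive multiple of the last coordinate of its
    block. [pole_sign] settles the case where both vanish, so the sign is odd everywhere. *)
Definition coord_sign q x : bool :=
  if x q != (2 * K)%N :> nat then neg (x q) else
  if x (last_coord q.1) != (2 * K)%N :> nat then neg (x (last_coord q.1))
  else pole_sign q.1 x.

(* A sign function for the equation [q] chosen so that a single flag survives. *)
Definition model q x : 'F_2 :=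
  (coord_sign q x (+) ((n <= q.2)%N && pole_sign (q.2 - n) x))%:R.

(** The class of the equation [(l, a)]: t_l for [a < n], and t_l + t_l' for [a = n + l']. *)
Definition chi q l : 'F_2 := ((q.1 == l) (+) (q.2 == n + l :> nat)%N)%:R.

Lemma bool_F2D (b b' : bool) : (b (+) b')%:R = b%:R + b'%:R :> 'F_2.
Proof. by case: b b' => -[]; exact/val_inj. Qed.

Lemma coord_sign_flip q l x : onsphere x ->
  coord_sign q (flip l x) = coord_sign q x (+) (q.1 == l).
Proof.
move=> Xx; rewrite /coord_sign pole_sign_flip // !flipE /=.
have -> : (l == q.1 :> nat) = (q.1 == l) by rewrite eq_sym.
case: (q.1 == l); last by rewrite !addbF.
rewrite /neg !rev_val !addbT.
have := ltn_ord (x q); have := ltn_ord (x (last_coord q.1)).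
move: (nat_of_ord (x q)) (nat_of_ord (x (last_coord q.1))) => i j ilt jlt.
have E k : (k < (4 * K).+1)%N -> ((4 * K - k)%N != (2 * K)%N) = (k != 2 * K)%N by lia.
have N k : (k < (4 * K).+1)%N -> (k != 2 * K)%N -> (4 * K - k < 2 * K)%N = ~~ (k < 2 * K)%N.
  by lia.
rewrite !E //; have [i2|_] := boolP (i != 2 * K)%N; first exact: N.
by have [j2|_] := boolP (j != 2 * K)%N; first exact: N.
Qed.

Lemma model_flip q l x : (q.2 < n + q.1)%N -> onsphere x ->
  model q (flip l x) = model q x + chi q l.
Proof.
move=> qlt Xx; rewrite -bool_F2D; congr (nat_of_bool _)%:R.
rewrite coord_sign_flip //; case: (leqP n q.2) => nq /=; last first.
  have -> : (q.2 == n + l :> nat)%N = false by lia.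
  by rewrite !addbF.
rewrite pole_sign_flip //; last by have := ltn_ord q.1; lia.
have -> : (l == q.2 - n :> nat)%N = (q.2 == n + l :> nat)%N by lia.
by rewrite addbACA.
Qed.

Section Step.
Variables (s : seq I) (q : I).
Hypotheses (uniq_sq : uniq (rcons s q)) (q_lt : (q.2 < n + q.1)%N).
Hypothesis (s_ge : forall p, p \in s -> (q.1 <= p.1)%N).
Let s' := rcons s q.

Let qs : q \notin s.
Proof. by move: uniq_sq; rewrite rcons_uniq => /andP[]. Qed.

Lemma live_rcons i : live s' i = (i == q) || live s i.
Proof. by rewrite /live mem_rcons inE orbA. Qed.

Lemma live_last l t : live t (last_coord l).
Proof. by rewrite /live /= eqxx orbT. Qed.

Lemma not_live : live s q = false.
Proof. by rewrite /live (negPf qs) /=; lia. Qed.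

Lemma slice_live t x i : slice t x -> live t i -> x i <> (2 * K)%N :> nat.
Proof.
move=> sx li; have [f [fi lf xf H]] := slice_pole i sx.
have [->|ne] := eqVneq i f; first by rewrite xf; lia.
by have [_] := H i erefl ne; rewrite li => + E; rewrite E oddM.
Qed.

Lemma pole_sign_agree k v w : (forall i : I, i.1 = k :> nat -> v i = w i) ->
  pole_sign k v = pole_sign k w.
Proof.
move=> vw; rewrite /pole_sign.
rewrite (@eq_pick _ _ (fun c : I => (c.1 == k :> nat) && extreme (w c))); last first.
  by move=> c /=; case: eqP => //= /vw ->.
by case: pickP => // c /andP[/eqP /vw -> _].
Qed.

(** Blocks below [q.1] have no equation left, so only their last coordinate is live and they are
    reduced to one vertex. *)
Lemma slice_even w (i : I) : slice s' w -> (i.1 < q.1)%N -> ~~ odd (w i).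
Proof.
move=> sw iq; have [f [fi lf wf H]] := slice_pole i sw.
have lv (p : I) : p.1 = i.1 -> live s' p -> p = last_coord i.1.
  move=> pi; rewrite live_rcons => /orP[/eqP pq|/orP[/s_ge|/eqP e]].
  - by move: iq; rewrite -pi pq ltnn.
  - by rewrite pi leqNgt iq.
  case: p pi e => l a /= -> e; congr pair; exact/val_inj.
have [->|ne] := eqVneq i f; first by rewrite wf oddM.
have [_] := H i erefl ne; case: ifP => [li|_ ->]; last by rewrite oddM.
by rewrite (lv _ erefl li) -(lv f fi lf) wf oddM.
Qed.

(** The second sign in [model] belongs to block [q.2 - n], which is below [q.1] and hence constant.
    This is how t_l + t_l' reduces to t_l. *)
Lemma model_neq v w : slice s' w -> (forall i : I, (i.1 < q.1)%N -> v i = w i) ->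
  (model q v != model q w) = (coord_sign q v != coord_sign q w).
Proof.
move=> sw vw; rewrite /model.
have -> : (n <= q.2)%N && pole_sign (q.2 - n) v = (n <= q.2)%N && pole_sign (q.2 - n) w.
  case: leqP => //= nq; apply: pole_sign_agree => i ik; apply: vw.
  by rewrite ik; lia.
by case: (coord_sign q v) (coord_sign q w) (_ && _) => -[] [].
Qed.

(** When coordinate [q] is at the origin, the last coordinate decides the sign. The sign changes
    exactly on entering the unit interval on the opposite side. *)
Definition lift_step v : cell :=
  upd v q (inord (if neg (v (last_coord q.1)) then (2 * K).+1 else (2 * K).-1)).

Lemma last_neq : last_coord q.1 != q.
Proof.
apply/eqP => E; move: q_lt; rewrite -[q in q.2]E /=; lia.
Qed.

(** Coordinate [q] of [w] is not at the origin and decides the sign there. A facet that does not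
    bring it to the origin keeps it on the same side. *)
Lemma slice_face w c b : slice s' w -> odd (w c) -> model q (face w c b) != model q w ->
  [/\ c = q, slice s (face w c b), w = lift_step (face w c b) &
      b = ~~ neg (face w c b (last_coord q.1))].
Proof.
move=> sw oc.
have lq := live_rcons q; rewrite eqxx /= in lq.
have wq := slice_live sw lq.
have wl := slice_live sw (live_last q.1 s').
rewrite model_neq // => [|i iq]; last first.
  rewrite ffunE; case: eqP => // e; by move: (slice_even sw iq); rewrite e oc.
have {wq} -> : coord_sign q w = neg (w q) by rewrite /coord_sign; case: eqP.
have cq : face w c b q = (2 * K)%N :> nat -> c = q.
  by rewrite ffunE; case: eqP => // _ e; have := slice_live sw lq; rewrite e.
have [fq|fq] := eqVneq (face w c b q : nat) (2 * K)%N; last first.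
  rewrite /coord_sign fq => /negP[]; apply/eqP; move: fq.
  rewrite ffunE; move: oc; have [<-|//] := eqVneq q c => oc.
  rewrite /neg mv_val //; have := slice_live sw lq.
  by clear -K_gt0; move: (nat_of_ord _) => j; case: b => /=; lia.
have {}cq := cq fq; subst c.
have fl : face w q b (last_coord q.1) = w (last_coord q.1).
  by rewrite ffunE (negPf last_neq).
have /eqP wl' := wl; rewrite /coord_sign fq eqxx /= fl wl' => ne.
have wqv : w q = (if b then (2 * K).-1 else (2 * K).+1) :> nat.
  move: fq; rewrite ffunE eqxx mv_val //.
  by case: (b); move: oc; move: (nat_of_ord _) => j; case: j => // j _ /= e; lia.
have bE : b = ~~ neg (w (last_coord q.1)).
  by move: ne; rewrite {2}/neg wqv; case: (b) => /=; case: neg => //=; lia.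
split=> //.
  apply/sliceP => l; have /sliceP/(_ l)[f [lf wf H]] := sw.
  have neq a : (l, a) <> q -> face w q b (l, a) = w (l, a).
    by rewrite ffunE; case: eqP.
  have fneq : (l, f) <> q by move=> E; move: oc; rewrite -E wf oddM.
  exists f; rewrite neq //; split=> //.
    by move: lf; rewrite live_rcons; case: eqP.
  move=> a af; have := H a af; rewrite live_rcons.
  by have [->|/eqP ne'] := eqVneq (l, a) q; rewrite ?not_live ?neq.
apply/ffunP => i; rewrite /lift_step [RHS]ffunE.
case: (i =P q) => [->|/eqP iq]; last by rewrite ffunE (negPf iq).
apply/val_inj; rewrite /= fl wqv bE if_neg inordK //.
by case: ifP => _; lia.
Qed.

Lemma slice_lift v : slice s v ->
  [/\ slice s' (lift_step v), odd (lift_step v q),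
      face (lift_step v) q (~~ neg (v (last_coord q.1))) = v &
      model q v != model q (lift_step v)].
Proof.
move=> sv.
have vq : v q = (2 * K)%N :> nat.
  have [f [fi lf vf H]] := slice_pole q sv.
  have qf : q != f by apply: contraTneq lf => <-; rewrite not_live.
  by have [_] := H q erefl qf; rewrite not_live.
have vl := slice_live sv (live_last q.1 s).
set B := neg _.
have wq : lift_step v q = (if B then (2 * K).+1 else (2 * K).-1) :> nat.
  by rewrite ffunE eqxx inordK // -/B; case: (B); lia.
have wi i : i != q -> lift_step v i = v i by move=> ne; rewrite ffunE (negPf ne).
have owq : odd (lift_step v q) by rewrite wq; case: (B); lia.
have sw : slice s' (lift_step v).
  apply/sliceP => l; have /sliceP/(_ l)[f [lf vf H]] := sv.
  have fneq : (l, f) != q by apply: contraTneq lf => ->; rewrite not_live.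
  exists f; rewrite live_rcons (negPf fneq) wi //; split=> // a af.
  rewrite live_rcons; have [->//|ne] := eqVneq (l, a) q.
  by rewrite wi //; exact: H.
split=> //.
  apply/ffunP => i; rewrite ffunE; case: eqP => [->|/eqP/wi//].
  apply/val_inj; rewrite /= mv_val // wq vq; case: (B) => //=; lia.
rewrite model_neq // => [|i iq]; last first.
  by rewrite wi //; apply: contraTneq iq => ->; rewrite ltnn.
rewrite /coord_sign vq eqxx /= wq; move/eqP: (vl) => ->; rewrite -/B.
have -> : (if B then (2 * K).+1 else (2 * K).-1) != (2 * K)%N by case: (B); lia.
by rewrite /neg wq; case: (B); lia.
Qed.

(** By [slice_face] and [slice_lift], the incidences at which the sign of [q] changes correspond
    bijectively to the cells of the smaller slice. *)
Lemma sum_slice_step :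
  \sum_(w | slice s' w) chain model s' w = \sum_(v | slice s v) chain model s v.
Proof.
transitivity (\sum_(p : cell * I * bool | [&& slice s' p.1.1, odd (p.1.1 p.1.2) &
     model q (face p.1.1 p.1.2 p.2) != model q p.1.1])
    chain model s (face p.1.1 p.1.2 p.2)).
  under eq_bigr => w _ do rewrite chain_rconsE /cobdry.
  rewrite pair_big_dep /= pair_big_dep /= [LHS]big_mkcond [RHS]big_mkcond /=.
  apply: eq_bigr => -[[w c] b] _ /=; rewrite andbT.
  case: (slice s' w) => //=; case: (odd (w c)) => //=.
  case: eqP => [->|]; first by rewrite addF2 mul0r.
  move: (model q _) (model q w) (chain _ _ _) => x y z.
  by case: (F2_cases x) => ->; case: (F2_cases y) => -> // _; rewrite ?addr0 ?add0r mul1r.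
rewrite (reindex_onto
  (fun v => (lift_step v, q, ~~ neg (v (last_coord q.1))))
  (fun p => face p.1.1 p.1.2 p.2)) /=.
  apply: eq_big => [v|v /andP[_ /eqP ->]] //.
  apply/idP/idP => [/andP[/and3P[sw ow ne] /eqP vE]|sv].
    by have [_] := slice_face sw ow ne; rewrite vE.
  by have [-> -> -> ->] := slice_lift sv; rewrite eqxx.
move=> [[w c] b] /= /and3P[sw ow ne].
by have [cq _ wE bE] := slice_face sw ow ne; rewrite -wE -bE cq.
Qed.

End Step.

Definition pole_cell : cell :=
  [ffun i : I => if (i.2 == n + i.1 :> nat)%N then inord (4 * K) else inord (2 * K)].

Lemma slice_nil x : slice [::] x = (x == pole_cell).
Proof.
have E (i : I) : pole_cell i = (if i.2 == n + i.1 :> nat then 4 * K else 2 * K)%N :> nat.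
  by rewrite ffunE; case: ifP => _; rewrite inordK //; lia.
apply/idP/eqP => [sx|->].
  apply/ffunP => i; apply/val_inj; rewrite /= E.
  have [f [fi lf xf H]] := slice_pole i sx.
  have lfE : f = last_coord i.1.
    case: f fi lf {H xf} => l a /= ->; rewrite /live /= => /eqP e.
    by congr pair; exact/val_inj.
  have [e|ne] := eqVneq i f; first by move: lf; rewrite /live /= -e => ->; rewrite e xf.
  have [_] := H i erefl ne; rewrite /live in_nil /=.
  case: eqP => // e; case/negP: ne; rewrite lfE {1}[i]surjective_pairing /last_coord.
  by rewrite xpair_eqE eqxx /=; apply/eqP/val_inj.
apply/sliceP => l; exists (last_coord l).2; rewrite live_last; split=> //.
  by rewrite E /= eqxx.
move=> a ne; have ne' : (a == n + l :> nat)%N = false.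
  by apply: contraNF ne => /eqP e; apply/eqP/val_inj.
by rewrite /live /= ne' E /= ne'.
Qed.

Lemma sum_slice_model (s : seq I) : uniq s -> (forall q, q \in s -> (q.2 < n + q.1)%N) ->
  pairwise (fun p q : I => (q.1 <= p.1)%N) s ->
  \sum_(w | slice s w) chain model s w = 1.
Proof.
elim/last_ind: s => [|s q IH] us ls.
  move=> _; under eq_bigl => w do rewrite slice_nil.
  rewrite big_pred1_eq /chain /= /init.
  suff -> : [forall c, ~~ odd (pole_cell c)] by [].
  by apply/forallP => c; rewrite ffunE; case: ifP => _; rewrite inordK ?oddM //; lia.
rewrite pairwise_rcons => /andP[/allP ge pw].
have qlt : (q.2 < n + q.1)%N by apply: ls; rewrite mem_rcons mem_head.
rewrite (sum_slice_step us qlt ge).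
apply: IH => //; first by move: us; rewrite rcons_uniq => /andP[].
by move=> p ps; apply: ls; rewrite mem_rcons inE ps orbT.
Qed.

(* Ordered by decreasing block: [slice_even] needs the blocks below [q.1] to be exhausted. *)
Definition equations : seq I :=
  sort (fun p q : I => (q.1 <= p.1)%N) (enum [pred q : I | (q.2 < n + q.1)%N]).

Lemma mem_equations q : (q \in equations) = (q.2 < n + q.1)%N.
Proof. by rewrite mem_sort mem_enum. Qed.

(** The given signs have the same characters as the model, so their chain has the same sum 1 over
    the fundamental domain. Some cell there has a nonzero value and thus carries a flag. *)
Lemma grid_antipodal_zero (sg : I -> cell -> bool) :
  (forall q l x, (q.2 < n + q.1)%N -> onsphere x ->
     sg q (flip l x) = sg q x (+) ((q.1 == l) (+) (q.2 == n + l :> nat)%N)) ->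
  exists2 w, onsphere w & forall q, (q.2 < n + q.1)%N ->
    exists v v', [/\ below v w, below v' w, onsphere v, onsphere v' & sg q v != sg q v'].
Proof.
move=> H; pose sg' q x : 'F_2 := (sg q x)%:R.
have Esg : equivariant chi sg' equations.
  by move=> q l x; rewrite mem_equations => qlt Xx; rewrite /sg' H // bool_F2D.
have Em : equivariant chi model equations.
  by move=> q l x; rewrite mem_equations => qlt Xx; exact: model_flip.
have [b Ib Hb] := chain_cobordant Esg Em.
have pw : pairwise (fun p q : I => (q.1 <= p.1)%N) equations.
  rewrite -sorted_pairwise; last by move=> p q r /= h1 h2; exact: leq_trans h2 h1.
  by apply: sort_sorted => p q; exact: leq_total.
have S1 : \sum_(w | slice equations w) chain sg' equations w = 1.
  have us : uniq equations by rewrite sort_uniq enum_uniq.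
  have lt q : q \in equations -> (q.2 < n + q.1)%N by rewrite mem_equations.
  have M := sum_slice_model us lt pw.
  have := sum_slice_cobdry equations Ib.
  rewrite -(eq_bigr _ (fun w sw => Hb w (slice_onsphere sw))) big_split /= M => S0.
  by apply: (addIr 1); rewrite S0 addF2.
have [w sw cw] : exists2 w, slice equations w & chain sg' equations w != 0.
  have [/existsP[w /andP[sw cw]]|no] :=
    boolP [exists w, slice equations w && (chain sg' equations w != 0)]; first by exists w.
  move: S1; rewrite big1 => [/eqP|w sw]; first by rewrite eq_sym oner_eq0.
  apply/eqP; apply: contraNT no => cw; apply/existsP; exists w; by rewrite sw.
exists w; first exact: slice_onsphere sw.
move=> q; rewrite -mem_equations => qe.
have [v [v' [? ? ? ? ne]]] := chain_flag cw (slice_onsphere sw) qe.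
by exists v, v'; split=> //; apply: contraNneq ne => E; rewrite /sg' E.
Qed.

End Grid.

(** * Linear inequalities and center points *)

Section LinearInequalities.
Variable F : realFieldType.

Lemma interpolate (J : finType) (lo hi : {pred J}) (f : J -> F) :
  (forall i k, i \in hi -> k \in lo -> f k <= f i) ->
  exists z, (forall i, i \in hi -> z <= f i) /\ (forall k, k \in lo -> f k <= z).
Proof.
move=> H; case: (pickP hi) => [i0 hi0|nohi].
  by exists (f [arg min_(i < i0 in hi) f i]%O); case: arg_minP => // i hi_i mi; split=> // k; exact: H.
case: (pickP lo) => [k0 lok0|nolo].
  exists (f [arg max_(k > k0 in lo) f k]%O); case: arg_maxP => // k lok mk; split=> // i.
  by rewrite [_ \in _]nohi.
by exists 0; split=> i; rewrite ?[_ \in hi]nohi ?[_ \in lo]nolo.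
Qed.

(* Fourier-Motzkin elimination of the first coordinate. *)
Lemma farkas m (J : finType) (a : J -> 'I_m -> F) (b : J -> F) :
  (exists p : 'I_m -> F, forall j, \sum_l p l * a j l <= b j) \/
  (exists y : J -> F, [/\ forall j, 0 <= y j, forall l, \sum_j y j * a j l = 0 &
     \sum_j y j * b j < 0]).
Proof.
elim: m J a b => [|m IH] J a b.
  have [/existsP[j bj]|no] := boolP [exists j, b j < 0].
    right; exists (fun i => (i == j)%:R); split=> [i|[]//|]; first by rewrite ler0n.
    rewrite (bigD1 j) //= eqxx mul1r big1 ?addr0 // => i /negPf ->; exact: mul0r.
  left; exists (fun=> 0) => j; rewrite big_ord0 leNgt.
  by apply: contra no => bj; apply/existsP; exists j.
(* Rows of the eliminated system: [inl i] keeps a row free of the first variable, and [inr (i, k)]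
   is the nonnegative combination that cancels it between rows of opposite signs. All other indices
   give the zero row. *)
pose c (t : J + J * J) (j : J) : F := match t with
  | inl i => ((a i ord0 == 0) && (j == i))%:R
  | inr (i, k) => if (0 < a i ord0) && (a k ord0 < 0) then
       (j == i)%:R * - a k ord0 + (j == k)%:R * a i ord0 else 0
  end.
have c_ge0 t j : 0 <= c t j.
  case: t => [i|[i k]] /=; first exact: ler0n.
  case: ifP => // /andP[ai ak].
  by rewrite addr_ge0 ?mulr_ge0 ?ler0n ?oppr_ge0 // ltW.
have sum1 i (f : J -> F) : \sum_j (j == i)%:R * f j = f i.
  rewrite (bigD1 i) //= eqxx mul1r big1 ?addr0 // => j /negPf ->; exact: mul0r.
have c_inl i (f : J -> F) : a i ord0 = 0 -> \sum_j c (inl i) j * f j = f i.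
  by move=> ai; rewrite /= ai eqxx /= sum1.
have c_inr i k (f : J -> F) : 0 < a i ord0 -> a k ord0 < 0 ->
    \sum_j c (inr (i, k)) j * f j = - a k ord0 * f i + a i ord0 * f k.
  move=> ai ak; rewrite /= ai ak /=.
  under eq_bigr do rewrite mulrDl -!mulrA.
  by rewrite big_split /= (sum1 i (fun j => - a k ord0 * f j)) (sum1 k (fun j => a i ord0 * f j)).
have c0 t : \sum_j c t j * a j ord0 = 0.
  case: t => [i|[i k]].
    have [ai|ai] := eqVneq (a i ord0) 0; first by rewrite c_inl.
    by apply: big1 => j _; rewrite /= (negPf ai) mul0r.
  case: (boolP ((0 < a i ord0) && (a k ord0 < 0))) => [/andP[ai ak]|nik].
    by rewrite c_inr //; ring.
  by apply: big1 => j _; rewrite /= (negPf nik) mul0r.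
have [[p Hp]|[y [y0 ya yb]]] := IH _ (fun t l => \sum_j c t j * a j (lift ord0 l))
  (fun t => \sum_j c t j * b j); [left|right].
  pose s j := \sum_l p l * a j (lift ord0 l).
  have Hs t : \sum_j c t j * s j <= \sum_j c t j * b j.
    apply: le_trans (Hp t); rewrite le_eqVlt; apply/orP; left; apply/eqP.
    under eq_bigr do rewrite mulr_sumr.
    rewrite exchange_big /=; apply: eq_bigr => l _; rewrite mulr_sumr.
    by apply: eq_bigr => j _; rewrite mulrCA.
  have [|z [zhi zlo]] := @interpolate J [pred j | a j ord0 < 0] [pred j | 0 < a j ord0]
      (fun j => (b j - s j) / a j ord0).
    move=> i k; rewrite !inE => ai ak; have := Hs (inr (i, k)); rewrite !c_inr // => h.
    rewrite ler_ndivrMr // mulrAC ler_pdivrMr //; lra.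
  exists (fun l => if unlift ord0 l is Some l' then p l' else z) => j.
  rewrite big_ord_recl unlift_none.
  under eq_bigr do rewrite liftK.
  rewrite -/(s j).
  have [aj|aj|aj] := ltrgtP (a j ord0) 0.
  - by have := zlo j aj; rewrite ler_ndivrMr //; lra.
  - by have := zhi j aj; rewrite ler_pdivlMr //; lra.
  by have := Hs (inl j); rewrite !c_inl // aj mulr0 add0r.
exists (fun j => \sum_t y t * c t j); split.
- by move=> j; apply: sumr_ge0 => t _; rewrite mulr_ge0.
- move=> l; under eq_bigr do rewrite mulr_suml.
  rewrite exchange_big /=.
  under eq_bigr do (under eq_bigr do rewrite -mulrA); under eq_bigr do rewrite -mulr_sumr.
  case: (unliftP ord0 l) => [l' ->|->]; first exact: ya.
  by apply: big1 => t _; rewrite c0 mulr0.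
under eq_bigr do rewrite mulr_suml.
rewrite exchange_big /=.
by under eq_bigr do (under eq_bigr do rewrite -mulrA); under eq_bigr do rewrite -mulr_sumr.
Qed.

Lemma dependent m (J : finType) (S : {set J}) (a : J -> 'I_m -> F) : (m < #|S|)%N ->
  exists z : J -> F, [/\ forall j, j \notin S -> z j = 0, exists j, z j != 0 &
    forall l, \sum_j z j * a j l = 0].
Proof.
move=> mS; pose A : 'M[F]_(#|S|, m) := \matrix_(i, l) a (enum_val i) l.
have rk : (0 < \rank (kermx A))%N by rewrite mxrank_ker subn_gt0 (leq_ltn_trans _ mS) ?rank_leq_col.
have [v /sub_kermxP vA v0] : exists2 v : 'rV_#|S|, (v <= kermx A)%MS & v != 0.
  by apply/rowV0Pn; rewrite -mxrank_eq0 -lt0n.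
pose z j := \sum_(i | enum_val i == j) v 0 i.
have zE i : z (enum_val i) = v 0 i.
  by rewrite /z (big_pred1 i) // => i' /=; rewrite (inj_eq enum_val_inj).
have zS j : j \notin S -> z j = 0.
  by move=> jS; apply: big1 => i /eqP ij; move: jS; rewrite -ij enum_valP.
exists z; split=> //.
  have [i vi] := rV0Pn _ v0; by exists (enum_val i); rewrite zE.
move=> l; rewrite (bigID (mem S)) /= [X in _ + X]big1 ?addr0; last first.
  by move=> j /zS ->; rewrite mul0r.
rewrite big_enum_val /=; transitivity ((v *m A) 0 l); last by rewrite vA mxE.
by rewrite mxE; apply: eq_bigr => i _; rewrite zE mxE.
Qed.

(* Caratheodory: a minimal certificate of infeasibility has at most [m + 1] nonzero weights. *)
Lemma farkas_support m (J : finType) (a : J -> 'I_m -> F) (b : J -> F) :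
  (exists p : 'I_m -> F, forall j, \sum_l p l * a j l <= b j) \/
  (exists y : J -> F, [/\ forall j, 0 <= y j, forall l, \sum_j y j * a j l = 0,
     \sum_j y j * b j < 0 & (#|[set j | y j != 0%R]| <= m.+1)%N]).
Proof.
have [|[y [y0 ya yb]]] := farkas a b; [by left|right].
elim: {y}_.+1 {-2}y (ltnSn #|[set j | y j != 0]|) y0 ya yb => // N IH y yN y0 ya yb.
set S := [set j | y j != 0] in yN.
have [Sm|Sm] := leqP #|S| m.+1; first by exists y; split.
(* With [b] as an extra column, moving [y] along the dependency [z] also preserves the value of the
   certificate; hence the bound [m + 1] on the support. *)
pose a' j (l : 'I_m.+1) := if unlift ord0 l is Some l' then a j l' else b j.
have [z [zS [j0 zj0] za']] := dependent a' Sm.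
have za l : \sum_j z j * a j l = 0.
  have := za' (lift ord0 l); rewrite /a'; by under eq_bigr do rewrite liftK.
have zb : \sum_j z j * b j = 0.
  have := za' ord0; rewrite /a'; by under eq_bigr do rewrite unlift_none.
wlog [k zk] : z zS j0 zj0 za zb {za'} / exists k, z k < 0.
  move=> W; have [zn|zp] := ltP (z j0) 0; first by apply: (W z _ j0) => //; exists j0.
  apply: (W (fun j => - z j) _ j0); rewrite ?oppr_eq0 //.
  - by move=> j /zS ->; rewrite oppr0.
  - by move=> l; under eq_bigr do rewrite mulNr; rewrite sumrN za oppr0.
  - by under eq_bigr do rewrite mulNr; rewrite sumrN zb oppr0.
  by exists j0; rewrite oppr_lt0 lt_def zj0.
(* Ratio test: [i] is the first weight to vanish when moving along [z], so the others are still
   nonnegative. *)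
pose i := [arg min_(i < k | z i < 0) (y i / - z i)]%O.
have [zi mi] : z i < 0 /\ forall j, z j < 0 -> y i / - z i <= y j / - z j.
  by rewrite /i; case: arg_minP => // i' zi' mi'; split.
pose t := y i / - z i.
have t0 : 0 <= t by rewrite divr_ge0 // oppr_ge0 ltW.
apply: (IH (fun j => y j + t * z j)).
- rewrite -ltnS; apply: leq_trans yN; rewrite ltnS; apply: proper_card.
  apply/properP; split.
    apply/subsetP => j; rewrite !inE; apply: contraNN => /eqP yj.
    by rewrite yj zS ?inE ?yj ?eqxx // mulr0 addr0.
  exists i; rewrite !inE.
    by apply: contraTneq zi => yi; rewrite zS ?ltxx // inE yi eqxx.
  by rewrite negbK /t; have := zi; move: (z i) (y i) => ? ? ?; rewrite invrN; apply/eqP; field; lra.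
- move=> j; have [zj|zj] := ltP (z j) 0; last by rewrite addr_ge0 // mulr_ge0.
  have := mi j zj; rewrite -/t ler_pdivlMr ?oppr_gt0 //; lra.
- move=> l; under eq_bigr do rewrite mulrDl -mulrA.
  by rewrite big_split /= ya -mulr_sumr za mulr0 addr0.
under eq_bigr do rewrite mulrDl -mulrA.
by rewrite big_split /= -mulr_sumr zb mulr0 addr0.
Qed.

(** [b] is the maximum over [T] of the minimum of [f] on [T]. It turns the condition that some [T]
    works into one linear inequality. *)
Lemma max_min (E : finType) (fam : {set {set E}}) (f : E -> F) :
  fam != set0 -> set0 \notin fam ->
  exists b, (exists2 T, T \in fam & forall e, e \in T -> b <= f e) /\
    (forall T, T \in fam -> exists2 e, e \in T & f e <= b).
Proof.
move=> /set0Pn[T0 T0f] no0.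
pose G e0 := [exists T in fam, [forall e in T, f e0 <= f e]].
have minT T : T \in fam -> exists2 e, e \in T & G e.
  move=> Tf; have /set0Pn[e1 e1T] : T != set0 by apply: contraNneq no0 => <-.
  case: (arg_minP f e1T) => e eT me; exists e => //; apply/existsP; exists T; rewrite Tf.
  by apply/forallP => e'; apply/implyP; exact: me.
have [e0 _ Ge0] := minT T0 T0f.
case: (arg_maxP f Ge0) => e1 /existsP[T /andP[Tf /forall_inP HT]] me.
exists (f e1); split; first by exists T.
by move=> T' /minT[e eT' /me]; exists e.
Qed.

(* The family [fam] is unavoidable for colourings with one more colour than the dimension;
   this is what makes Helly's theorem applicable. *)
Lemma center_point m (E J : finType) (fam : {set {set E}}) (a : J -> 'I_m -> F)
    (h : E -> 'I_m -> F) (B : F) :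
  (forall c : E -> 'I_m.+1, exists2 T, T \in fam & exists k, forall e, e \in T -> c e = k) ->
  (forall e l, `|h e l| <= B) -> 0 <= B ->
  exists p : 'I_m -> F, (forall l, `|p l| <= B) /\
    forall j, exists2 T, T \in fam &
      forall e, e \in T -> \sum_l p l * a j l <= \sum_l h e l * a j l.
Proof.
move=> ram hB B0.
have [fam0|no0] := boolP (set0 \in fam).
  exists (fun=> 0); split=> [l|j]; first by rewrite normr0.
  by exists set0 => // e; rewrite inE.
have fam_ne : fam != set0.
  by have [T Tf _] := ram (fun=> ord0); apply/set0Pn; exists T.
(* The added directions are plus and minus the unit vectors; their inequalities bound the
   coordinates of [p] by [B]. *)
pose a' (j : J + 'I_m * bool) (l : 'I_m) : F := match j with
  inl j => a j l | inr (l', s) => (-1) ^+ s * (l == l')%:R end.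
pose f j e := \sum_l h e l * a' j l.
have /boolp.choice[b Hb] j := max_min (f j) fam_ne no0.
have b1 j := (Hb j).1; have b2 j := (Hb j).2.
have [[p Hp]|[y [y0 ya yb yS]]] := farkas_support a' b.
  have fE l s e : f (inr (l, s)) e = (-1) ^+ s * h e l.
    rewrite /f /= (bigD1 l) //= eqxx mulr1 big1 ?addr0 1?mulrC // => l' /negPf ->.
    by rewrite !mulr0.
  have pE l (s : bool) : (-1) ^+ s * p l <= B.
    have [T Tf bT] := b1 (inr (l, s)).
    have [e eT] := b2 (inr (l, s)) T Tf.
    have := Hp (inr (l, s)); rewrite /= (bigD1 l) //= eqxx mulr1 big1 ?addr0; last first.
      by move=> l' /negPf ->; rewrite !mulr0.
    rewrite mulrC => h1; have := bT e eT; rewrite fE => h2 _.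
    apply: le_trans (le_trans h1 h2) _; apply: le_trans (ler_norm _) _.
    by rewrite normrM normrX normrN1 expr1n mul1r.
  exists p; split=> [l|j].
    rewrite ler_norml lerNl; have := pE l true; have := pE l false.
    by rewrite expr0 expr1 mul1r mulN1r => -> ->.
  have [T Tf bT] := b1 (inl j); exists T => // e eT.
  exact: le_trans (Hp (inl j)) (bT e eT).
exfalso; set S := [set j | y j != 0] in yS.
(* The directions weighted by [y] sum to 0, while the weighted bounds have a negative sum, so at
   each [e] some direction exceeds its bound. Such a direction, from the support of [y], is the
   colour of [e]; a monochromatic [T] contradicts the maximality of that bound. *)
have colour e : exists j, y j * b j < y j * f j e.
  apply/existsP; apply: contraT => /existsPn H.
  suff : 0 <= \sum_j y j * b j by rewrite leNgt yb.
  have yf : \sum_j y j * f j e = 0.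
    under eq_bigr do rewrite mulr_sumr.
    rewrite exchange_big /= big1 // => l _.
    under eq_bigr do rewrite mulrCA.
    by rewrite -mulr_sumr ya mulr0.
  rewrite -[leLHS]yf; apply: ler_sum => j _; rewrite leNgt; exact: H.
pose jc e := xchoose (colour e).
have jcP e : y (jc e) * b (jc e) < y (jc e) * f (jc e) e := xchooseP (colour e).
have jcS e : jc e \in S.
  by rewrite inE; apply: contraTneq (jcP e) => ->; rewrite !mul0r ltxx.
have [T Tf [k HT]] := ram (fun e => inord (index (jc e) (enum S))).
have /set0Pn[e0 e0T] : T != set0 by apply: contraNneq no0 => <-.
have same e : e \in T -> jc e = jc e0.
  move=> eT; have lt e' : (index (jc e') (enum S) < m.+1)%N.
    by apply: leq_trans yS; rewrite cardE index_mem mem_enum jcS.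
  have := congr1 val (etrans (HT e eT) (esym (HT e0 e0T))); rewrite /= !inordK //.
  by move=> /(congr1 (nth (jc e0) (enum S))); rewrite !nth_index ?mem_enum ?jcS.
have [e eT fe] := b2 (jc e0) T Tf.
have := jcP e; rewrite same //; apply/negP; rewrite -leNgt.
exact: ler_wpM2l.
Qed.

End LinearInequalities.

(** * Transversals over the real numbers *)

Section RealTransversal.
Import boolp classical_sets reals topology normedtype sequences.
Import numFieldNormedType.Exports Rstruct.

(** * Subsequences and sequential continuity *)

Section Subsequences.
Variable R : realType.
Local Open Scope classical_set_scope.

Lemma increasing_seq_ge (phi : nat -> nat) : increasing_seq phi -> forall N, (N <= phi N)%N.
Proof.
move=> /increasing_seqP H; elim=> // N IH.
by apply: leq_ltn_trans IH _; have := H N; rewrite ltEnat.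
Qed.

Lemma cvg_increasing (u : nat -> R) (l : R) (phi : nat -> nat) :
  increasing_seq phi -> u @ \oo --> l -> (u \o phi) @ \oo --> l.
Proof.
move=> inc ul; apply: cvg_comp ul => A [N _ NA].
by exists N => // k /= Nk; apply: NA; apply: leq_trans (increasing_seq_ge inc k).
Qed.

Lemma bounded_subsequence1 (u : nat -> R) (B : R) : (forall N, `|u N| <= B) ->
  exists2 phi : nat -> nat, increasing_seq phi & exists l : R, (u \o phi) @ \oo --> l.
Proof.
move=> uB; have [|l [_ cl]] := @segment_compact R (- B) B (u @ \oo) _.
  by exists 0%N => // N _ /=; rewrite in_itv /= -ler_norml.
by have [phi inc ul] := (cluster_eventually_cvg u l).1 cl; exists phi => //; exists l.
Qed.

Lemma bounded_subsequence (J : finType) (u : nat -> J -> R) (B : R) :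
  (forall N j, `|u N j| <= B) ->
  exists2 phi : nat -> nat, increasing_seq phi &
    exists l : J -> R, forall j, (fun N => u (phi N) j) @ \oo --> l j.
Proof.
move=> uB.
suff H (s : seq J) : exists2 phi : nat -> nat, increasing_seq phi &
    exists l : J -> R, forall j, j \in s -> (fun N => u (phi N) j) @ \oo --> l j.
  have [phi inc [l Hl]] := H (enum J); exists phi => //; exists l => j.
  by apply: Hl; rewrite mem_enum.
elim: s => [|j s [phi inc [l Hl]]].
  by exists id => //; exists (fun=> 0).
have [psi inc' [lj Hlj]] := bounded_subsequence1 (fun N => uB (phi N) j).
exists (phi \o psi).
  by move=> x y /=; rewrite (inc (psi x)) -leEnat inc'.
exists (fun i => if i == j then lj else l i) => i; rewrite inE.
case: eqP => [->|_] //= si.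
exact: cvg_increasing inc' (Hl i si).
Qed.

End Subsequences.

(** Limits are only taken along extracted sequences, so coordinatewise sequential continuity is
    enough. *)
Definition sequentially_continuous (R : realType) (J : Type) (f : (J -> R) -> R) :=
  forall (u : nat -> J -> R) (x : J -> R),
    (forall j, (fun N => u N j) @ \oo --> x j)%classic ->
    ((fun N => f (u N)) @ \oo --> f x)%classic.

Section SequentialContinuity.
Variables (R : realType) (J : Type).
Implicit Types f g : (J -> R) -> R.

Lemma seq_continuous_proj (j : J) : sequentially_continuous (fun x : J -> R => x j).
Proof. by move=> u x; exact. Qed.

Lemma seq_continuous_cst (c : R) : sequentially_continuous (fun _ : J -> R => c).
Proof. by move=> u x _; exact: cvg_cst. Qed.

Lemma seq_continuousD f g : sequentially_continuous f -> sequentially_continuous g ->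
  sequentially_continuous (fun x => f x + g x).
Proof. by move=> cf cg u x ux; apply: cvgD; [exact: cf|exact: cg]. Qed.

Lemma seq_continuousN f : sequentially_continuous f -> sequentially_continuous (fun x => - f x).
Proof. by move=> cf u x ux; apply: cvgN; exact: cf. Qed.

Lemma seq_continuousM f g : sequentially_continuous f -> sequentially_continuous g ->
  sequentially_continuous (fun x => f x * g x).
Proof. by move=> cf cg u x ux; apply: cvgM; [exact: cf|exact: cg]. Qed.

Lemma seq_continuous_norm f : sequentially_continuous f ->
  sequentially_continuous (fun x => `|f x|).
Proof. by move=> cf u x ux; apply: cvg_norm; exact: cf. Qed.

Lemma seq_continuous_ext f g : f =1 g -> sequentially_continuous f -> sequentially_continuous g.
Proof. by move=> /funext ->. Qed.

Lemma seq_continuous_sum (K : Type) (s : seq K) (P : pred K) (f : K -> (J -> R) -> R) :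
  (forall k, sequentially_continuous (f k)) ->
  sequentially_continuous (fun x => \sum_(k <- s | P k) f k x).
Proof.
move=> cf; elim: s => [|k s IH].
  by apply: (seq_continuous_ext _ (@seq_continuous_cst 0)) => x; rewrite big_nil.
have [Pk|Pk] := boolP (P k); last first.
  by apply: (seq_continuous_ext _ IH) => x; rewrite big_cons (negPf Pk).
by apply: (seq_continuous_ext _ (seq_continuousD (cf k) IH)) => x; rewrite big_cons Pk.
Qed.

Lemma seq_continuous_prod (K : Type) (s : seq K) (P : pred K) (f : K -> (J -> R) -> R) :
  (forall k, sequentially_continuous (f k)) ->
  sequentially_continuous (fun x => \prod_(k <- s | P k) f k x).
Proof.
move=> cf; elim: s => [|k s IH].
  by apply: (seq_continuous_ext _ (@seq_continuous_cst 1)) => x; rewrite big_nil.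
have [Pk|Pk] := boolP (P k); last first.
  by apply: (seq_continuous_ext _ IH) => x; rewrite big_cons (negPf Pk).
by apply: (seq_continuous_ext _ (seq_continuousM (cf k) IH)) => x; rewrite big_cons Pk.
Qed.

Lemma seq_continuous_le f (u : nat -> J -> R) (x : J -> R) (c : R) :
  sequentially_continuous f -> (forall j, (fun N => u N j) @ \oo --> x j)%classic ->
  (forall N, f (u N) <= c) -> f x <= c.
Proof.
move=> cf ux fc; apply: (ler_cvg_to (cf u x ux) (cvg_cst c)).
by apply: nearW => N; exact: fc.
Qed.

End SequentialContinuity.

(** * Common zeros on a product of spheres *)

Section BorsukUlam.
Variables (n m d : nat).
Hypothesis nmd : (n + m <= d)%N.
Notation I := ('I_m * 'I_d)%type.

Definition antipode (R : pzRingType) (l : 'I_m) (x : I -> R) : I -> R :=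
  fun i => if i.1 == l then - x i else x i.

(* The equation [(l, a)] is odd in the [l]-th sphere; for [a = n + l'] it is also odd in the
   [l']-th one. *)
Definition parity (q : I) (l : 'I_m) : bool := (q.1 == l) (+) (q.2 == n + l :> nat)%N.

Lemma approximate_antipodal_zero (R : realFieldType) (f : I -> (I -> R) -> R) (N : nat) :
  (forall (q : I) l x, (q.2 < n + q.1)%N -> f q (antipode l x) = (-1) ^+ parity q l * f q x) ->
  exists W : I -> R, [/\ forall i, `|W i| <= 1, forall l, exists a, `|W (l, a)| = 1 &
    forall q : I, (q.2 < n + q.1)%N -> exists V V' : I -> R,
      [/\ forall i, `|V i - W i| <= N.+1%:R^-1,
          forall i, `|V' i - W i| <= N.+1%:R^-1 & f q V * f q V' <= 0]].
Proof.
move=> fE; pose K := N.+1; have K0 : 0 < K%:R :> R by rewrite ltr0n.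
pose r (x : {ffun I -> 'I_(4 * K).+1}) (i : I) : R := ((x i)%:R - (2 * K)%:R) / (2 * K)%:R.
have rflip l x : r (flip l x) = antipode l (r x).
  apply: funext => i; rewrite /r /antipode flipE; case: ifP => // _.
  rewrite rev_val natrB; last by rewrite -ltnS; exact: ltn_ord.
  rewrite -mulNr; congr (_ / _); rewrite !natrM.
  by move: (K%:R : R) ((x i)%:R : R) => k j; lra.
(* Where [f q] vanishes, a combinatorial sign of the same parity is substituted, so that [sg] is
   equivariant everywhere. *)
pose sg q x := if f q (r x) == 0 then
    pole_sign q.1 x (+) ((n <= q.2)%N && pole_sign (q.2 - n) x) else f q (r x) < 0.
have [//||w Xw Hw] := @grid_antipodal_zero n m d K nmd _ sg.
  move=> q l x qlt Xx; rewrite /sg rflip fE // mulf_eq0 signr_eq0 /=.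
  rewrite -/(parity q l); case: eqP => [_|/eqP nz].
    rewrite (pole_sign_flip nmd (ltn0Sn N)) // (_ : (l == q.1 :> nat) = (q.1 == l)); last by rewrite eq_sym.
    rewrite /parity; case: (leqP n q.2) => nq /=; last first.
      have -> : (q.2 == n + l :> nat)%N = false by lia.
      by rewrite !addbF.
    rewrite (pole_sign_flip nmd (ltn0Sn N)) //; last by have := ltn_ord q.1; lia.
    have -> : (l == q.2 - n :> nat)%N = (q.2 == n + l :> nat)%N by lia.
    by rewrite addbACA.
  case: (parity q l); rewrite ?mul1r ?addbF // mulN1r oppr_lt0 addbT.
  by rewrite -leNgt le_eqVlt eq_sym (negPf nz).
have K2 : 0 < (2 * K)%:R :> R by rewrite ltr0n.
have close v : below v w -> forall i, `|r v i - r w i| <= N.+1%:R^-1.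
  move=> vw i; rewrite /r -mulrBl normrM normfV (gtr0_norm K2) ler_pdivrMr //.
  rewrite natrM mulrCA mulVf ?mulr1 ?(gt_eqF K0) //.
  have [->|[_ _]] := vw i; first by rewrite subrr normr0.
  case=> ->; rewrite -?natr1.
    rewrite (_ : _ - _ - _ = 1) ?normr1 ?ler1n //; lra.
  rewrite (_ : _ - _ - _ = -1) ?normrN1 ?ler1n //; lra.
exists (r w); split=> [i|l|q qlt].
- rewrite /r normrM normfV (gtr0_norm K2) ler_pdivrMr // mul1r ler_norml.
  have := ltn_ord (w i); rewrite ltnS -(ler_nat R) !natrM => h.
  by have := ler0n R (w i); move: h; rewrite lerBrDr lerBlDr; lra.
- have /forallP/(_ l)/existsP[a /orP wa] := Xw; exists a; rewrite /r.
  case: wa => /eqP ->.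
    by rewrite sub0r mulNr divff ?gt_eqF // normrN1.
  by rewrite (_ : (4 * K)%:R - _ = (2 * K)%:R) ?divff ?gt_eqF ?normr1 // !natrM; lra.
have [v [v' [vw vw' Xv Xv' ne]]] := Hw q qlt.
exists (r v), (r v'); split; [exact: close|exact: close|].
have [->|nz] := eqVneq (f q (r v)) 0; first by rewrite mul0r.
have [->|nz'] := eqVneq (f q (r v')) 0; first by rewrite mulr0.
move: ne; rewrite /sg (negPf nz) (negPf nz').
case: (ltrgtP (f q (r v)) 0) nz => // h _; case: (ltrgtP (f q (r v')) 0) nz' => // h' _ _.
  by rewrite ltW // nmulr_rlt0.
by rewrite ltW // pmulr_rlt0.
Qed.

(** Points with values of opposite signs converge to the same limit [x], so the square of [f q x] is
    at most 0. *)
Theorem antipodal_zero (R : realType) (f : I -> (I -> R) -> R) :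
  (forall q, sequentially_continuous (f q)) ->
  (forall (q : I) l x, (q.2 < n + q.1)%N -> f q (antipode l x) = (-1) ^+ parity q l * f q x) ->
  exists x : I -> R, [/\ forall i, `|x i| <= 1, forall l, 1 <= \sum_a `|x (l, a)| &
    forall q : I, (q.2 < n + q.1)%N -> f q x = 0].
Proof.
move=> fc fE.
have /choice[W HW] N := approximate_antipodal_zero N fE.
have [phi inc [x Wx]] := @bounded_subsequence R I W 1 (fun N => let: And3 h _ _ := HW N in h).
have leE g c : sequentially_continuous g -> (forall N, g (W (phi N)) <= c) -> g x <= c.
  by move=> cg; exact: seq_continuous_le cg Wx.
exists x; split.
- move=> i; apply: (leE (fun y => `|y i|) 1) => [|N]; last by have [] := HW (phi N).
  exact/seq_continuous_norm/seq_continuous_proj.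
- move=> l; rewrite -lerN2; apply: (leE (fun y => - \sum_a `|y (l, a)|)) => [|N].
    apply: seq_continuousN; apply: seq_continuous_sum => a.
    exact/seq_continuous_norm/seq_continuous_proj.
  have [_ /(_ l)[a Wa] _] := HW (phi N).
  by rewrite lerN2 (bigD1 a) //= Wa lerDl sumr_ge0.
move=> q qlt.
have /choice[V HV] N : exists VV' : (I -> R) * (I -> R),
    [/\ forall i, `|VV'.1 i - W N i| <= N.+1%:R^-1,
     forall i, `|VV'.2 i - W N i| <= N.+1%:R^-1 & f q VV'.1 * f q VV'.2 <= 0].
  by have [_ _ /(_ q qlt)[v [v' H]]] := HW N; exists (v, v').
have lim (v : nat -> I -> R) : (forall N i, `|v N i - W N i| <= N.+1%:R^-1) ->
    forall i, ((fun N => v (phi N) i) @ \oo --> x i)%classic.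
  move=> vW i; have -> : (fun N => v (phi N) i) =
      (fun N => W (phi N) i + (v (phi N) i - W (phi N) i)).
    by apply: funext => N; rewrite addrC subrK.
  rewrite -[x i]addr0; apply: cvgD; first exact: Wx.
  apply: norm_cvg0.
  apply: (@squeeze_cvgr _ _ _ _ (fun=> 0) (fun N => N.+1%:R^-1)).
  - apply: nearW => N; rewrite normr_ge0 /= (le_trans (vW _ _)) // lef_pV2 ?posrE ?ltr0n //.
    by rewrite ler_nat ltnS increasing_seq_ge.
  - exact: cvg_cst.
  - exact: cvg_harmonic.
have [V1 V2] : (forall i, ((fun N => (V (phi N)).1 i) @ \oo --> x i)%classic) /\
    (forall i, ((fun N => (V (phi N)).2 i) @ \oo --> x i)%classic).
  by split; [apply: (lim (fun N => (V N).1))|apply: (lim (fun N => (V N).2))] => N i;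
    have [] := HV N.
have : f q x * f q x <= 0.
  apply: (@ler_cvg_to _ _ _ _ _ _ _ _ (cvgM (fc q _ _ V1) (fc q _ _ V2)) (cvg_cst 0)).
  by apply: nearW => N /=; have [] := HV (phi N).
by rewrite -expr2 => fx; apply/eqP; rewrite -sqrf_eq0 eq_le fx sqr_ge0.
Qed.

End BorsukUlam.

(** * Symmetric nets in a cube *)

Section CubeGrid.
Variables (R : archiRealFieldType) (m K : nat).
Hypothesis K_gt0 : (0 < K)%N.
Notation grid := {ffun 'I_m -> 'I_(2 * K).+1}.

Definition grid_point (z : grid) (l : 'I_m) : R := ((z l)%:R - K%:R) / K%:R.

Definition grid_flip (l : 'I_m) (z : grid) : grid :=
  [ffun l' => if l' == l then rev_ord (z l') else z l'].

Let K0 : 0 < K%:R :> R. Proof. by rewrite ltr0n. Qed.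

Lemma grid_flipK l : involutive (grid_flip l).
Proof.
by move=> z; apply/ffunP => i; rewrite !ffunE; case: eqP => // _; rewrite rev_ordK.
Qed.

Lemma grid_point_flip l z l' :
  grid_point (grid_flip l z) l' = (-1) ^+ (l' == l) * grid_point z l'.
Proof.
rewrite /grid_point ffunE; case: eqP => _; last by rewrite mul1r.
rewrite /= subSS natrB; last by rewrite -ltnS; exact: ltn_ord.
by rewrite expr1 mulN1r -mulNr natrM; congr (_ / _); move: (K%:R : R) => k; lra.
Qed.

Lemma grid_point_le1 z l : `|grid_point z l| <= 1.
Proof.
rewrite normrM normfV (gtr0_norm K0) ler_pdivrMr // mul1r ler_norml.
have := ltn_ord (z l); rewrite ltnS -(ler_nat R) natrM => h.
by have := ler0n R (z l); move: h; move: (K%:R : R) (_%:R : R) => k y; lra.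
Qed.

Lemma grid_approx (t : 'I_m -> R) : (forall l, `|t l| <= 1) ->
  exists z, forall l, `|grid_point z l - t l| <= K%:R^-1.
Proof.
move=> t1; exists [ffun l => inord (Num.truncn ((t l + 1) * K%:R))] => l.
have /andP[t0 t2] : 0 <= (t l + 1) * K%:R <= (2 * K)%:R.
  have := t1 l; rewrite ler_norml natrM => /andP[h1 h2]; apply/andP; split.
    by apply: mulr_ge0; [lra|exact: ltW].
  by apply: ler_wpM2r; [exact: ltW|lra].
rewrite /grid_point ffunE inordK; last first.
  by rewrite ltnS -(ler_nat R); apply: le_trans t2; rewrite truncn_le.
have /andP[h1 h2] := truncn_itv t0.
move: h1 h2; rewrite -natr1; set y : R := (Num.truncn _)%:R => h1 h2.
have -> : (y - K%:R) / K%:R - t l = (y - K%:R - t l * K%:R) / K%:R.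
  by rewrite [in RHS]mulrBl mulfK ?lt0r_neq0.
rewrite normrM normfV (gtr0_norm K0) ler_piMl ?invr_ge0 ?(ltW K0) //.
move: h1 h2; rewrite mulrDl mul1r ler_norml.
by move: y (t l * K%:R) (K%:R : R) => y u k; lra.
Qed.

End CubeGrid.

(** * Continuous selection of approximate center points *)

Section CenterTransversal.
Variables (R : realType) (n m d : nat).
Hypothesis nmd : (n + m <= d)%N.
Variables (E : finType) (fam : 'I_n.+1 -> {set {set E}}) (v : E * 'I_d -> R).
Hypothesis ramsey_fam : forall i (c : E -> 'I_m.+1),
  exists2 T, T \in fam i & exists k, forall e, e \in T -> c e = k.
Notation I := ('I_m * 'I_d)%type.

(** A bound for all coordinates of the vertices; the summand 1 makes it positive and lets it bound
    the frame vectors too. *)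
Let B : R := 1 + \sum_e \sum_a `|v (e, a)|.
Let B_ge1 : 1 <= B.
Proof. by rewrite lerDl; apply: sumr_ge0 => e _; apply: sumr_ge0. Qed.
Let B_gt0 : 0 < B. Proof. exact: lt_le_trans B_ge1. Qed.

(* Pairing of [v e] with the vectors [x (l, _)]: the coordinates of the point [v e] modulo the
   orthogonal complement of their span. *)
Definition coordinates (x : I -> R) (e : E) (l : 'I_m) : R := \sum_a x (l, a) * v (e, a).

Lemma coordinates_le x e l : (forall i, `|x i| <= 1) -> `|coordinates x e l| <= B.
Proof.
move=> x1; apply: le_trans (ler_norm_sum _ _ _) _; rewrite /B (bigD1 e) //=.
apply: (@le_trans _ _ (\sum_a `|v (e, a)|)).
  by apply: ler_sum => a _; rewrite normrM ler_piMl.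
rewrite addrCA lerDl addr_ge0 // sumr_ge0 // => e' _; exact: sumr_ge0.
Qed.

Lemma coordinates_antipode x e l l' :
  coordinates (antipode l x) e l' = (-1) ^+ (l' == l) * coordinates x e l'.
Proof.
rewrite /coordinates mulr_sumr; apply: eq_bigr => a _; rewrite /antipode /=.
by case: eqP => _; rewrite ?expr1 ?mulN1r ?mul1r ?mulNr.
Qed.

Section Selection.
Variables (M Z : nat).
(** [M] gives the net of directions and the tolerance [1 / M]. [Z] gives the net of points, so fine
    that rounding to it costs less than the tolerance in every direction. *)
Hypotheses (M_gt0 : (0 < M)%N) (Z_large : m%:R * B * M%:R < Z%:R).
Let eps : R := M%:R^-1.
Let Z_gt0 : (0 < Z)%N.
Proof.
by rewrite -(ltr_nat R); apply: le_lt_trans Z_large; rewrite !mulr_ge0 // ltW.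
Qed.

Notation dir := {ffun 'I_m -> 'I_(2 * M).+1}.
Notation net := {ffun 'I_m -> 'I_(2 * Z).+1}.
Local Notation gp := (grid_point R).

Definition slack (x : I -> R) (z : net) (j : dir) (e : E) : R :=
  eps + \sum_l (coordinates x e l - B * gp z l) * gp j l.

(* positive exactly when [B * gp z] is an [eps]-approximate center point for [fam i] *)
Definition weight (i : 'I_n.+1) (x : I -> R) (z : net) : R :=
  \prod_j \sum_(T in fam i) \prod_(e in T) (slack x z j e + `|slack x z j e|).

(** The selected point is [B * (moment / mass)], the weighted mean of the net. *)
Definition mass i x : R := \sum_z weight i x z.
Definition moment i x l : R := \sum_z weight i x z * gp z l.

Lemma pos_ge0 (t : R) : 0 <= t + `|t|.
Proof. by case: (ger0P t) => ht; lra. Qed.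

Lemma pos_gt0 (t : R) : (0 < t + `|t|) = (0 < t).
Proof. by case: (ger0P t) => ht; apply/idP/idP; lra. Qed.

Lemma weight_ge0 i x z : 0 <= weight i x z.
Proof.
by apply: prodr_ge0 => j _; apply: sumr_ge0 => T _; apply: prodr_ge0 => e _; exact: pos_ge0.
Qed.

Lemma weight_gt0P i x z : reflect (forall j, exists2 T, T \in fam i &
    forall e, e \in T -> 0 < slack x z j e) (0 < weight i x z).
Proof.
have P0 (T : {set E}) j : 0 <= \prod_(e in T) (slack x z j e + `|slack x z j e|).
  by apply: prodr_ge0 => e _; exact: pos_ge0.
apply: (iffP idP) => [w0 j|H].
  have : \sum_(T in fam i) \prod_(e in T) (slack x z j e + `|slack x z j e|) != 0.
    by move: w0; rewrite lt_def => /andP[/prodf_neq0/(_ j isT)].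
  rewrite psumr_neq0 => [/hasP[T _ /andP[Tf]]|T _] //.
  rewrite lt_def => /andP[/prodf_neq0 nz _]; exists T => // e eT.
  by rewrite -pos_gt0 lt_def nz ?pos_ge0.
apply: prodr_gt0 => j _; have [T Tf HT] := H j.
rewrite (bigD1 T) //= ltr_wpDr ?sumr_ge0 //.
by apply: prodr_gt0 => e /HT; rewrite pos_gt0.
Qed.

Lemma slack_antipode l x z j e :
  slack (antipode l x) (grid_flip l z) (grid_flip l j) e = slack x z j e.
Proof.
congr (_ + _); apply: eq_bigr => l' _.
rewrite coordinates_antipode !grid_point_flip //.
by case: eqP => _; rewrite ?expr1; ring.
Qed.

Lemma weight_antipode i l x z : weight i (antipode l x) (grid_flip l z) = weight i x z.
Proof.
rewrite /weight (reindex_inj (inv_inj (@grid_flipK m M l))).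
by do 3?[apply: eq_bigr => ? _]; rewrite slack_antipode.
Qed.

Lemma mass_antipode i l x : mass i (antipode l x) = mass i x.
Proof.
rewrite /mass (reindex_inj (inv_inj (@grid_flipK m Z l))).
by apply: eq_bigr => z _; rewrite weight_antipode.
Qed.

Lemma moment_antipode i l x l' :
  moment i (antipode l x) l' = (-1) ^+ (l' == l) * moment i x l'.
Proof.
rewrite /moment (reindex_inj (inv_inj (@grid_flipK m Z l))) mulr_sumr.
by apply: eq_bigr => z _; rewrite weight_antipode grid_point_flip // mulrCA.
Qed.

(** An exact center point, rounded to the net, has positive weight. *)
Lemma mass_gt0 i x : (forall c, `|x c| <= 1) -> 0 < mass i x.
Proof.
move=> x1.
have [p [pB Hp]] := center_point (@grid_point R m M) (ramsey_fam i)
  (fun e l => coordinates_le e l x1) (ltW B_gt0).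
have [|z zp] := @grid_approx R m Z Z_gt0 (fun l => p l / B).
  by move=> l; rewrite normrM normfV (gtr0_norm B_gt0) ler_pdivrMr // mul1r.
rewrite /mass (bigD1 z) //= ltr_wpDr ?sumr_ge0 // => [? _|]; first exact: weight_ge0.
apply/weight_gt0P => j; have [T Tf HT] := Hp j; exists T => // e eT.
have bound : `|\sum_l (p l - B * gp z l) * gp j l| <= m%:R * (B * Z%:R^-1).
  apply: le_trans (ler_norm_sum _ _ _) _.
  rewrite -[m in m%:R]card_ord -sum1_card natr_sum mulr_suml; apply: ler_sum => l _.
  rewrite mul1r normrM -[leRHS]mulr1; apply: ler_pM => //; last exact: grid_point_le1.
  rewrite -[p l](divfK (lt0r_neq0 B_gt0)) [p l / B * B]mulrC -mulrBr normrM (gtr0_norm B_gt0).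
  by rewrite ler_pM2l // distrC.
have small : m%:R * (B * Z%:R^-1) < eps.
  by rewrite mulrA ltr_pdivrMr ?ltr0n // /eps [ltRHS]mulrC ltr_pdivlMr ?ltr0n.
rewrite /slack; have := HT e eT.
have -> : \sum_l (coordinates x e l - B * gp z l) * gp j l =
    \sum_l coordinates x e l * gp j l - \sum_l p l * gp j l +
    \sum_l (p l - B * gp z l) * gp j l.
  rewrite -sumrB -big_split; apply: eq_bigr => l _ /=; ring.
move: bound; rewrite ler_norml => /andP[b1 _].
by move: small b1; set u := \sum_l _; set u' := \sum_l _; set u'' := \sum_l _; lra.
Qed.

(** In direction [j] the mean does not go beyond the farthest net point of positive weight, so the
    [T] of that point serves. *)
Lemma center_approx i x (p : 'I_m -> R) : (forall c, `|x c| <= 1) ->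
  (forall l, p l = B * (moment i x l / mass i x)) ->
  (forall l, `|p l| <= B) /\ forall j : dir, exists2 T, T \in fam i &
    forall e, e \in T -> \sum_l p l * gp j l <= \sum_l coordinates x e l * gp j l + eps.
Proof.
move=> x1 pE; have w0 := mass_gt0 i x1; split=> [l|j].
  rewrite pE normrM (gtr0_norm B_gt0) ler_piMr ?(ltW B_gt0) //.
  rewrite normrM normfV (gtr0_norm w0) ler_pdivrMr // mul1r.
  apply: le_trans (ler_norm_sum _ _ _) _; apply: ler_sum => z _.
  by rewrite normrM (ger0_norm (weight_ge0 _ _ _)) ler_piMr ?weight_ge0 ?grid_point_le1.
have [z0 wz0] : exists z, 0 < weight i x z.
  apply: contrapT => no; move: w0; rewrite /mass big1 ?ltxx // => z _.
  apply/eqP; rewrite eq_le weight_ge0 andbT leNgt; apply/negP => wz; apply: no; by exists z.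
pose val (z : net) : R := \sum_l gp z l * gp j l.
have [z [wz zmax]] : exists z, 0 < weight i x z /\
    forall z', 0 < weight i x z' -> val z' <= val z.
  by exists [arg max_(z > z0 | 0 < weight i x z) val z]%O; case: arg_maxP.
have [T Tf HT] := elimT (weight_gt0P i x z) wz j; exists T => // e /HT; rewrite /slack.
have pv : \sum_l p l * gp j l <= B * val z.
  have -> : \sum_l p l * gp j l = B * ((\sum_z' weight i x z' * val z') / mass i x).
    under eq_bigr do rewrite pE -mulrA.
    rewrite -mulr_sumr; congr (_ * _); under eq_bigr do rewrite mulrAC.
    rewrite -mulr_suml; congr (_ / _); rewrite /moment.
    under eq_bigr do rewrite mulr_suml.
    rewrite exchange_big /=; apply: eq_bigr => z' _; rewrite /val mulr_sumr.
    by apply: eq_bigr => l _; rewrite -mulrA.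
  rewrite ler_pM2l // ler_pdivrMr // mulrC /mass mulr_suml; apply: ler_sum => z' _.
  have [wz'|] := ltP 0 (weight i x z'); first by rewrite ler_pM2l // zmax.
  by move=> wz'; have -> : weight i x z' = 0; [apply/eqP; rewrite eq_le wz' weight_ge0|rewrite !mul0r].
have -> : \sum_l (coordinates x e l - B * gp z l) * gp j l =
    \sum_l coordinates x e l * gp j l - B * val z.
  by rewrite /val mulr_sumr -sumrB; apply: eq_bigr => l _; ring.
by move: pv; set u := \sum_l _; set u' := B * _; set u'' := \sum_l _; lra.
Qed.

(* The equations [(l, a)], [a < n], say that the [n + 1] approximate center points have the same
   [l]-th coordinate; the remaining ones say that the vectors [x (l, _)] are orthogonal. *)
Definition system (q : I) (x : I -> R) : R :=
  if (q.2 < n)%N then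
    mass ord0 x * moment (inord q.2.+1) x q.1 - mass (inord q.2.+1) x * moment ord0 x q.1
  else \sum_(l : 'I_m | q.2 == n + l :> nat) \sum_a x (q.1, a) * x (l, a).

Lemma system_antipode (q : I) l x : (q.2 < n + q.1)%N ->
  system q (antipode l x) = (-1) ^+ parity n q l * system q x.
Proof.
move=> qlt; rewrite /system /parity; case: ltnP => qn.
  have -> : (q.2 == n + l :> nat)%N = false by lia.
  by rewrite addbF !mass_antipode !moment_antipode; ring.
have qd : (q.2 - n < m)%N by have := ltn_ord q.1; lia.
have Eq (l' : 'I_m) : (q.2 == n + l' :> nat)%N = (l' == Ordinal qd).
  apply/idP/idP => /eqP h; apply/eqP; last by rewrite h /=; lia.
  by apply: val_inj => /=; lia.
rewrite !(eq_bigl _ _ Eq) !big_pred1_eq Eq mulr_sumr.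
have ne : q.1 != Ordinal qd.
  by apply/eqP => /(congr1 val) /= h; move: qlt; lia.
apply: eq_bigr => a _; rewrite /antipode /= ![_ == l]eq_sym.
case: (l =P q.1) => [->|_]; first by rewrite (negPf ne) /= expr1; ring.
by case: (l =P Ordinal qd) => _ /=; rewrite ?expr1 ?expr0; ring.
Qed.

Lemma weight_continuous i z : sequentially_continuous (fun x => weight i x z).
Proof.
have cs j e : sequentially_continuous (fun x => slack x z j e).
  apply: seq_continuousD; first exact: seq_continuous_cst.
  apply: seq_continuous_sum => l; apply: seq_continuousM; last exact: seq_continuous_cst.
  apply: seq_continuousD; last exact: seq_continuous_cst.
  apply: seq_continuous_sum => a; apply: seq_continuousM; last exact: seq_continuous_cst.
  exact: seq_continuous_proj.
apply: seq_continuous_prod => j; apply: seq_continuous_sum => T.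
apply: seq_continuous_prod => e; apply: seq_continuousD; first exact: cs.
exact: seq_continuous_norm.
Qed.

(** Equality of the quotients [moment / mass] is stated in cross-multiplied form, so continuity
    needs no division. *)
Lemma system_continuous q : sequentially_continuous (system q).
Proof.
have cmass i : sequentially_continuous (mass i).
  apply: seq_continuous_sum => z; exact: weight_continuous.
have cmom i l : sequentially_continuous (moment i ^~ l).
  apply: seq_continuous_sum => z; apply: seq_continuousM; first exact: weight_continuous.
  exact: seq_continuous_cst.
rewrite /system; case: (q.2 < n)%N.
  by apply: seq_continuousD; last apply: seq_continuousN; apply: seq_continuousM.
apply: seq_continuous_sum => l; apply: seq_continuous_sum => a.
by apply: seq_continuousM; exact: seq_continuous_proj.
Qed.

Lemma approximate_transversal : exists (x : I -> R) (p : 'I_m -> R),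
  [/\ forall c, `|x c| <= 1, forall l, `|p l| <= B,
      forall l, 1 <= \sum_a `|x (l, a)|,
      forall l l' : 'I_m, (l' < l)%N -> \sum_a x (l, a) * x (l', a) = 0 &
      forall i (j : dir), exists2 T, T \in fam i & forall e, e \in T ->
        \sum_l p l * gp j l <= \sum_l coordinates x e l * gp j l + eps].
Proof.
have [x [x1 xn xz]] := antipodal_zero nmd system_continuous system_antipode.
pose p l := B * (moment ord0 x l / mass ord0 x); exists x, p.
have pE i l : p l = B * (moment i x l / mass i x).
  have [->//|i0] := eqVneq i ord0.
  have i0' : (0 < i)%N by rewrite lt0n.
  (* Equation [(l, i - 1)] compares family [i] with family 0. *)
  have alt : (i.-1 < n)%N by have := ltn_ord i; lia.
  have ad : (i.-1 < d)%N by apply: leq_trans nmd; rewrite ltn_addr.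
  have := xz (l, Ordinal ad); rewrite /system /= alt => /(_ (ltn_addr _ alt)).
  have -> : inord i.-1.+1 = i by rewrite prednK // inord_val.
  move=> /eqP; rewrite subr_eq0 => /eqP h.
  have m0 := mass_gt0 ord0 x1; have mi := mass_gt0 i x1.
  congr (_ * _); apply/eqP; rewrite eqr_div ?lt0r_neq0 //.
  by rewrite mulrC -h mulrC.
split=> //.
- by have [] := center_approx x1 (pE ord0).
- move=> l l' ll'; have ad : (n + l' < d)%N.
    by apply: leq_trans nmd; rewrite ltn_add2l.
  have ge : (n + l' < n)%N = false by lia.
  have := xz (l, Ordinal ad); rewrite /system /= ltn_add2l ge => /(_ ll').
  rewrite (eq_bigl (pred1 l')) ?big_pred1_eq // => l'' /=.
  by rewrite eqn_add2l eq_sym.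
by move=> i; have [] := center_approx x1 (pE i).
Qed.

End Selection.

Lemma scale_to_cube (lam : 'I_m -> R) : exists2 s : R, 0 < s & forall l, `|lam l / s| <= 1.
Proof.
pose s := 1 + \sum_l `|lam l|.
have s0 : 0 < s by rewrite ltr_wpDr ?ltr01 // sumr_ge0.
exists s => // l; rewrite normrM normfV (gtr0_norm s0) ler_pdivrMr // mul1r /s.
by rewrite (bigD1 l) //= addrCA lerDl addr_ge0 ?sumr_ge0.
Qed.

(** Limit of approximate transversals. The condition on [lam] is invariant under positive scaling,
    so [lam] may be moved into the cube and approximated by directions of the nets. *)
Theorem real_transversal : exists (x : I -> R) (p : 'I_m -> R),
  [/\ forall l, \sum_a x (l, a) * x (l, a) <> 0,
      forall l l' : 'I_m, l != l' -> \sum_a x (l, a) * x (l', a) = 0 &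
      forall (lam : 'I_m -> R) i, exists2 T, T \in fam i & forall e, e \in T ->
        \sum_l p l * lam l <= \sum_l coordinates x e l * lam l].
Proof.
have large M : m%:R * B * M%:R < (Num.truncn (m%:R * B * M%:R : R)).+1%:R :> R.
  by have /andP[] := truncn_itv (mulr_ge0 (mulr_ge0 (ler0n R m) (ltW B_gt0)) (ler0n R M)).
have /choice[W HW] N : exists w : I + 'I_m -> R,
  [/\ forall c, `|w (inl c)| <= 1, forall l, `|w (inr l)| <= B,
      forall l, 1 <= \sum_a `|w (inl (l, a))|,
      forall l l' : 'I_m, (l' < l)%N -> \sum_a w (inl (l, a)) * w (inl (l', a)) = 0 &
      forall i (j : {ffun 'I_m -> 'I_(2 * N.+1).+1}), exists2 T, T \in fam i &
        forall e, e \in T -> \sum_l w (inr l) * grid_point R j l <=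
          \sum_l coordinates (w \o inl) e l * grid_point R j l + N.+1%:R^-1].
  have [x [p H]] := approximate_transversal (ltn0Sn N) (large N.+1).
  by exists (fun c => match c with inl c => x c | inr l => p l end).
have [|phi inc [w Ww]] := @bounded_subsequence R (I + 'I_m)%type W B.
  move=> N [c|l]; have [h1 h2 _ _ _] := HW N; last exact: h2.
  exact: le_trans (h1 c) B_ge1.
have leE g c : sequentially_continuous g -> (forall N, g (W (phi N)) <= c) -> g w <= c.
  by move=> cg; exact: seq_continuous_le cg Ww.
have prj c : sequentially_continuous (fun y : I + 'I_m -> R => y c).
  exact: seq_continuous_proj.
have dot_cont l l' : sequentially_continuous
    (fun y : I + 'I_m -> R => \sum_a y (inl (l, a)) * y (inl (l', a))).
  by apply: seq_continuous_sum => a; apply: seq_continuousM.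
exists (w \o inl), (w \o inr); split=> [l|l l' ne|lam i] /=.
- move=> /eqP; rewrite psumr_eq0 => [/allP w0|a _]; last by rewrite -expr2 sqr_ge0.
  have : - \sum_a `|w (inl (l, a))| <= -1.
    apply: (leE (fun y => - \sum_a `|y (inl (l, a))|)) => [|N].
      apply: seq_continuousN; apply: seq_continuous_sum => a.
      exact: seq_continuous_norm.
    by rewrite lerN2; have [_ _ + _ _] := HW (phi N); exact.
  suff -> : \sum_a `|w (inl (l, a))| = 0 by rewrite oppr0 lerNr oppr0 ler10.
  apply: big1 => a _; apply/eqP; rewrite normr_eq0.
  by have := w0 a (mem_index_enum _); rewrite /= mulf_eq0 orbb.
- wlog ll' : l l' ne / (l' < l)%N.
    move=> H; have [|lt|/val_inj e] := ltngtP l l'; last by rewrite e eqxx in ne.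
      by move=> lt; under eq_bigr do rewrite mulrC; apply: H; rewrite // eq_sym.
    exact: H.
  have wN N : \sum_a W N (inl (l, a)) * W N (inl (l', a)) = 0.
    by have [_ _ _ + _] := HW N; exact.
  apply/eqP; rewrite eq_le; apply/andP; split.
    by apply: (leE _ _ (dot_cont l l')) => N; rewrite wN.
  rewrite -oppr_le0; apply: (leE _ _ (seq_continuousN (dot_cont l l'))) => N.
  by rewrite wN oppr0.
have [s s0 lam1] := scale_to_cube lam.
have /choice[g Hg] N : exists g : 'I_m -> R,
    (exists j : {ffun 'I_m -> 'I_(2 * N.+1).+1}, g = grid_point R j) /\
    forall l, `|g l - lam l / s| <= N.+1%:R^-1.
  have [j Hj] := @grid_approx R m N.+1 (ltn0Sn N) _ lam1.
  by exists (grid_point R j); split=> //; exists j.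
(* The good [T] may vary with [N]. If every [T] failed in the limit, then, the family being finite,
   all would fail at some [N] by more than the vanishing tolerance. *)
apply: contrapT => no.
pose gap (e : E) (y : (I + 'I_m) + 'I_m -> R) : R :=
  \sum_l y (inl (inr l)) * y (inr l) -
  \sum_l (\sum_a y (inl (inl (l, a))) * v (e, a)) * y (inr l).
have gap_cont e : sequentially_continuous (gap e).
  apply: seq_continuousD; last apply: seq_continuousN; apply: seq_continuous_sum => l;
    apply: seq_continuousM; try exact: seq_continuous_proj.
  apply: seq_continuous_sum => a; apply: seq_continuousM; last exact: seq_continuous_cst.
  exact: seq_continuous_proj.
pose u N (c : (I + 'I_m) + 'I_m) : R :=
  match c with inl c => W (phi N) c | inr l => g (phi N) l end.
pose u' (c : (I + 'I_m) + 'I_m) : R :=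
  match c with inl c => w c | inr l => lam l / s end.
have eps0 : ((fun N => (phi N).+1%:R^-1 : R) @ \oo --> (0 : R))%classic.
  exact: (cvg_increasing inc (@cvg_harmonic R)).
have uu' c : ((fun N => u N c) @ \oo --> u' c)%classic.
  case: c => [c|l] /=; first exact: Ww.
  have -> : (fun N => g (phi N) l) = (fun N => lam l / s + (g (phi N) l - lam l / s)).
    by apply: funext => N; rewrite addrC subrK.
  rewrite -[X in (_ --> X)%classic]addr0; apply: cvgD; first exact: cvg_cst.
  apply: norm_cvg0; apply: (@squeeze_cvgr _ _ _ _ (fun=> 0) (fun N => (phi N).+1%:R^-1)) => //.
    by apply: nearW => N; rewrite normr_ge0 /=; exact: (Hg _).2.
  exact: cvg_cst.
have ev T : (\forall N \near \oo, T \in fam i ->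
    exists2 e, e \in T & (phi N).+1%:R^-1 < gap e (u N))%classic.
  have [Tf|_] := boolP (T \in fam i); last by apply: nearW.
  have [e eT gape] : exists2 e, e \in T & 0 < gap e u'.
    apply: contrapT => no'; apply: no; exists T => // e eT.
    rewrite leNgt; apply/negP => lt; apply: no'; exists e => //.
    rewrite /gap subr_gt0 /=; under eq_bigr do rewrite mulrA.
    by under [ltRHS]eq_bigr do rewrite mulrA; rewrite -!mulr_suml ltr_pM2r ?invr_gt0.
  have cv : ((fun N => gap e (u N) - (phi N).+1%:R^-1) @ \oo --> gap e u' - 0)%classic.
    by apply: cvgB => //; exact: gap_cont.
  rewrite subr0 in cv; apply: filterS (cvgr_gt _ cv _ gape) => N.
  by rewrite subr_gt0 => lt _; exists e.
have /filter_ex[N HN] : (\forall N \near \oo, forall T, T \in fam i ->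
    exists2 e, e \in T & (phi N).+1%:R^-1 < gap e (u N))%classic.
  exact: filter_forall.
have [[j gj] _] := Hg (phi N).
have [_ _ _ _ /(_ i j)[T Tf]] := HW (phi N); rewrite -gj => HT.
have [e eT] := HN T Tf; rewrite /gap ltrBrDl; apply/negP; rewrite -leNgt.
exact: HT.
Qed.

End CenterTransversal.

Lemma transversal_sentence_real (R : realType) (n m d : nat) (E : finType)
    (fam : 'I_n.+1 -> {set {set E}}) : (n + m <= d)%N ->
  (forall i (c : E -> 'I_m.+1),
    exists2 T, T \in fam i & exists k, forall e, e \in T -> c e = k) ->
  transversal_sentence m d fam R.
Proof.
move=> nmd ram v; have [x [p [x0 xo Hx]]] := real_transversal nmd v ram.
(* The point in the span of the orthogonal frame whose pairings with the frame vectors are the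
   [p l]. *)
pose q a := \sum_l p l / (\sum_b x (l, b) * x (l, b)) * x (l, a).
have qx l : \sum_a q a * x (l, a) = p l.
  rewrite /q; under eq_bigr do rewrite mulr_suml.
  rewrite exchange_big /= (bigD1 l) //= [X in _ + X]big1 ?addr0 => [|l' ne].
    under eq_bigr do rewrite -mulrA.
    by rewrite -mulr_sumr divfK //; apply/eqP; exact: x0.
  under eq_bigr do rewrite -mulrA.
  by rewrite -mulr_sumr (xo _ _ ne) mulr0.
exists (fun c => match c with inl a => q a | inr c => x c end) => /=; split=> // lam i.
have [T Tf HT] := Hx lam i; exists T => // e /HT; congr (_ <= _).
  under [RHS]eq_bigr do rewrite mulr_sumr.
  rewrite exchange_big; apply: eq_bigr => l _ /=.
  rewrite -qx mulr_suml; apply: eq_bigr => a _; ring.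
under [RHS]eq_bigr do rewrite mulr_sumr.
rewrite exchange_big; apply: eq_bigr => l _ /=.
rewrite /coordinates mulr_suml; apply: eq_bigr => a _; ring.
Qed.

Lemma transversal_sentence_rcf (R : rcfType) (n m d : nat) (E : finType)
    (fam : 'I_n.+1 -> {set {set E}}) : (n + m <= d)%N ->
  (forall i (c : E -> 'I_m.+1),
    exists2 T, T \in fam i & exists k, forall e, e \in T -> c e = k) ->
  transversal_sentence m d fam R.
Proof.
move=> nmd ram.
have H (S : realType) : transversal_sentence m d fam S.
  exact: transversal_sentence_real nmd ram.
exact: transversal_sentence_transfer (H Rdefinitions.R).
Qed.

End RealTransversal.

(** * Ramsey numbers *)

Section Ramsey.
Local Open Scope nat_scope.

Lemma asboolP (P : Prop) : reflect P (asbool P).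
Proof. by rewrite /asbool; case: excluded_middle_informative => h; constructor. Qed.

Lemma subset_of_card (T : finType) (S : {set T}) a : a <= #|S| ->
  exists2 X : {set T}, X \subset S & #|X| = a.
Proof.
move=> aS; exists [set x in take a (enum S)].
  by apply/subsetP => x; rewrite inE => /mem_take; rewrite mem_enum.
rewrite cardsE; have /card_uniqP -> : uniq (take a (enum S)) by rewrite take_uniq ?enum_uniq.
by rewrite size_takel // -cardE.
Qed.

Definition monochromatic (T : finType) (d : nat) (c : {set T} -> bool) (b : bool) (X : {set T}) :=
  forall Y : {set T}, Y \subset X -> #|Y| = d -> c Y = b.

(** Fix a point [x] and colour the [d]-sets [Y] by the colour of [x |: Y]. Inside a set
    monochromatic for this colouring, a set one element short in that colour is completed by [x]. *)
Lemma ramsey_exists d a b : exists N, forall (T : finType) (S : {set T}) (c : {set T} -> bool),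
  N <= #|S| -> (exists X : {set T}, [/\ X \subset S, #|X| = a & monochromatic d c true X]) \/
               (exists X : {set T}, [/\ X \subset S, #|X| = b & monochromatic d c false X]).
Proof.
elim: d a b => [|d IHd] a b.
  exists (maxn a b) => T S c; rewrite geq_max => /andP[aS bS].
  case c0: (c set0); [left|right].
    have [X XS Xa] := subset_of_card aS; exists X; split=> // Y _ /cards0_eq ->; exact: c0.
  have [X XS Xb] := subset_of_card bS; exists X; split=> // Y _ /cards0_eq ->; exact: c0.
have empty (T : finType) (S : {set T}) c v :
    exists X : {set T}, [/\ X \subset S, #|X| = 0 & monochromatic d.+1 c v X].
  exists set0; split; rewrite ?sub0set ?cards0 // => Y; rewrite subset0 => /eqP ->.
  by rewrite cards0.
elim: a b => [|a IHa] b; first by exists 0 => T S c _; left.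
elim: b => [|b [q Hq]]; first by exists 0 => T S c _; right.
have [p Hp] := IHa b.+1; have [N HN] := IHd p q.
exists N.+1 => T S c NS.
have [x xS] : exists x, x \in S by apply/card_gt0P; apply: leq_trans NS.
have NS' : N <= #|S :\ x| by move: NS; rewrite (cardsD1 x) xS.
have extend (X Z : {set T}) v : Z \subset S :\ x -> monochromatic d (fun Y => c (x |: Y)) v Z ->
    X \subset Z -> monochromatic d.+1 c v X ->
    [/\ x |: X \subset S, #|x |: X| = #|X|.+1 & monochromatic d.+1 c v (x |: X)].
  move=> ZS HZ XZ HX; have xX : x \notin X.
    by apply/negP => /(subsetP XZ)/(subsetP ZS); rewrite !inE eqxx.
  split; last 1 first.
  - move=> Y YX Yd; have [xY|xY] := boolP (x \in Y); last first.
      apply: HX => //; apply/subsetP => y yY; have := subsetP YX _ yY.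
      by rewrite !inE => /predU1P[e|//]; rewrite -e yY in xY.
    rewrite -(setD1K xY); apply: HZ.
      by apply: subset_trans XZ; rewrite subDset.
    by apply/eqP; rewrite -eqSS -Yd (cardsD1 x Y) xY.
  - rewrite subUset sub1set xS; apply: subset_trans XZ _; apply: subset_trans ZS _.
    exact: subsetDl.
  by rewrite cardsU1 xX.
have sub (X Z : {set T}) : X \subset Z -> Z \subset S :\ x -> X \subset S.
  by move=> XZ ZS; apply: subset_trans (subset_trans XZ ZS) (subsetDl _ _).
case: (HN T (S :\ x) (fun Y => c (x |: Y)) NS') => -[Z [ZS Zc HZ]].
  case: (Hp T Z c); first by rewrite Zc.
    move=> [X [XZ Xc HX]]; left; exists (x |: X).
    by have [h1 h2 h3] := extend X Z true ZS HZ XZ HX; split; rewrite // h2 Xc.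
  by move=> [X [XZ Xc HX]]; right; exists X; split=> //; exact: sub XZ ZS.
case: (Hq T Z c); first by rewrite Zc.
  by move=> [X [XZ Xc HX]]; left; exists X; split=> //; exact: sub XZ ZS.
move=> [X [XZ Xc HX]]; right; exists (x |: X).
by have [h1 h2 h3] := extend X Z false ZS HZ XZ HX; split; rewrite // h2 Xc.
Qed.

Lemma ramseyP d a b : ramsey_prop d a b (ramsey d a b).
Proof.
rewrite /ramsey; case: excluded_middle_informative => [h|[]].
  by case: ex_minnP => N /asboolP.
have [N HN] := ramsey_exists d a b; exists N; apply/asboolP => c.
have [] := HN 'I_N setT c; first by rewrite cardsT card_ord.
  by move=> [X [_ Xa HX]]; left; exists X; split=> // Y YX Yd; rewrite HX.
by move=> [X [_ Xb HX]]; right; exists X.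
Qed.

Lemma ramsey_min d a b N : ramsey_prop d a b N -> ramsey d a b <= N.
Proof.
move=> HN; rewrite /ramsey; case: excluded_middle_informative => // h.
by case: ex_minnP => N' _; apply; apply/asboolP.
Qed.

Lemma ramsey_mono d a b a' b' : a <= a' -> b <= b' -> ramsey d a b <= ramsey d a' b'.
Proof.
move=> aa bb; apply: ramsey_min => c.
case: (@ramseyP d a' b' c) => -[X [Xc HX]]; [left|right].
  rewrite -Xc in aa; have [X' sX Xa] := subset_of_card aa; exists X'; split=> // Y YX.
  by apply: HX; exact: subset_trans sX.
rewrite -Xc in bb; have [X' sX Xb] := subset_of_card bb; exists X'; split=> // Y YX.
by apply: HX; exact: subset_trans sX.
Qed.

Lemma ramsey_subset d a b (T : finType) (S : {set T}) (c : {set T} -> bool) :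
  ramsey d a b <= #|S| ->
  (exists X : {set T}, [/\ X \subset S, #|X| = a & monochromatic d c true X]) \/
  (exists X : {set T}, [/\ X \subset S, #|X| = b & monochromatic d c false X]).
Proof.
move=> NS; pose f (i : 'I_(ramsey d a b)) : T := enum_val (widen_ord NS i).
have f_inj : injective f by move=> i j /enum_val_inj/(congr1 val) /= /val_inj.
have fS (X : {set 'I_(ramsey d a b)}) : f @: X \subset S.
  by apply/subsetP => y /imsetP[i _ ->]; exact: enum_valP.
have pull v (X : {set 'I_(ramsey d a b)}) :
    monochromatic d (fun Y : {set 'I_(ramsey d a b)} => c (f @: Y)) v X -> monochromatic d c v (f @: X).
  move=> HX Y YX Yd.
  have YE : Y = f @: (f @^-1: Y).
    apply/setP => y; apply/idP/imsetP => [yY|[i + ->]]; last by rewrite inE.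
    have /imsetP[i _ yi] := subsetP YX _ yY.
    by exists i => //; rewrite inE -yi.
  rewrite YE; apply: HX; last by rewrite -(card_imset _ f_inj) -YE.
  apply/subsetP => i; rewrite inE => /(subsetP YX)/imsetP[j jX /f_inj ->//].
case: (@ramseyP d a b (fun Y => c (f @: Y))) => -[X [Xc HX]]; [left|right];
  exists (f @: X); split; rewrite ?card_imset //; apply: pull => //.
Qed.

Lemma mult_mono d c x y : x <= y -> mult d c x <= mult d c y.
Proof.
move=> xy; rewrite /mult; elim: c.-1 => //= n IH.
by rewrite /oplus -!subn1 leq_sub2r // ramsey_mono.
Qed.

(** The highest colour is played against all the others merged; without it, the other summand of
    [oplus] handles one colour fewer. *)
Lemma mult_monochromatic d c x (T : finType) (S : {set T}) (chi : {set T} -> nat) :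
  (forall Y, chi Y < c.+1) -> mult d c.+1 x < #|S| ->
  exists X : {set T}, [/\ X \subset S, #|X| = x.+1 &
    exists k, forall Y : {set T}, Y \subset X -> #|Y| = d -> chi Y = k].
Proof.
elim: c S chi => [|c IH] S chi chic; rewrite /mult /= => lt.
  have [X XS Xx] := subset_of_card lt; exists X; split=> //.
  by exists 0 => Y _ _; have := chic Y; rewrite ltnS leqn0 => /eqP.
rewrite -/(mult d c.+1 x) in lt.
(* [oplus] is a Ramsey number minus 1, so exceeding it means reaching that number. *)
have le : ramsey d x.+1 (mult d c.+1 x).+1 <= #|S|.
  by move: lt; rewrite /oplus; case: ramsey.
case: (ramsey_subset (fun Y => chi Y == c.+1) le) => -[X [XS Xc HX]].
  exists X; split=> //; exists c.+1 => Y YX Yd; apply/eqP; exact: HX.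
(* The highest colour is absent from the [d]-subsets of [X]; on other sets it is replaced by 0 to
   satisfy the bound. *)
pose chi' (Y : {set T}) := if chi Y < c.+1 then chi Y else 0.
have [|| Z [ZX Zc [k Hk]]] := IH X chi'.
- by move=> Y; rewrite /chi'; case: ifP.
- by rewrite Xc.
exists Z; split=> //; first exact: subset_trans XS.
exists k => Y YZ Yd; rewrite -(Hk Y) // /chi'.
have := chic Y; rewrite ltnS leq_eqVlt; have -> /= : (chi Y == c.+1) = false.
  by apply: HX => //; exact: subset_trans ZX.
by move=> ->.
Qed.

(** A largest monochromatic [X] works, since otherwise one with one more element would exist. As
    [0 < d], the empty set is vacuously monochromatic. *)
Lemma mult_unavoidable d c (T : finType) (chi : {set T} -> nat) :
  0 < d -> (forall Y, chi Y < c.+1) ->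
  exists X : {set T}, #|T| <= mult d c.+1 #|X| /\
    exists k, forall Y : {set T}, Y \subset X -> #|Y| = d -> chi Y = k.
Proof.
move=> d0 chic.
pose P (X : {set T}) := asbool (exists k, forall Y : {set T}, Y \subset X -> #|Y| = d -> chi Y = k).
have P0 : P set0.
  apply/asboolP; exists 0 => Y; rewrite subset0 => /eqP ->; rewrite cards0 => e.
  by rewrite -e in d0.
case: (arg_maxnP (fun X : {set T} => #|X|) P0) => X /asboolP HX maxX.
exists X; split=> //; rewrite leqNgt; apply/negP; rewrite -cardsT => lt.
have [Z [_ Zc HZ]] := mult_monochromatic chic lt.
by have := maxX Z (introT (asboolP _) HZ); rewrite Zc /= ltnn.
Qed.

End Ramsey.

(** * Hyperplane arrangements *)

Lemma dotE (R : rcfType) d (u v : 'rV[R]_d) : dot u v = \sum_a u 0 a * v 0 a.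
Proof. by rewrite /dot mxE; apply: eq_bigr => a _; rewrite mxE. Qed.

Lemma dotDZ (R : rcfType) d (u v w : 'rV[R]_d) t :
  dot u (v + t *: w) = dot u v + t * dot u w.
Proof.
rewrite !dotE mulr_sumr -big_split; apply: eq_bigr => a _ /=.
by rewrite !mxE mulrDr mulrCA.
Qed.

(** A linear form bounded below on a flat vanishes on its directions, so [a] lies in the double
    orthogonal complement of the row space of [U]. *)
Lemma flat_halfspace (R : rcfType) m d (U : 'M[R]_(m, d)) (p a : 'rV[R]_d) b :
  \rank U = m -> (forall x, in_flat p (kermx U^T) x -> b < dot a x) ->
  exists lam : 'rV[R]_m, a = lam *m U.
Proof.
move=> rU H; set K := kermx U^T in H.
have aK (w : 'rV_d) : (w <= K)%MS -> dot a w = 0.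
  move=> wK; apply/eqP; apply: contraT => nz.
  (* Moving along [w] until the form equals [b] exactly contradicts strictness. *)
  have := H (p + (b - dot a p) / dot a w *: w).
  rewrite /in_flat addrC addKr scalemx_sub // => /(_ isT).
  by rewrite dotDZ divfK // addrC subrK ltxx.
apply/submxP.
have sub : (U <= kermx K^T)%MS.
  apply/sub_kermxP; apply: trmx_inj; rewrite trmx_mul trmxK trmx0; exact: mulmx_ker.
have aK' : (a <= kermx K^T)%MS.
  apply/sub_kermxP; apply/rowP => i; rewrite [RHS]mxE.
  rewrite -(aK (row i K)) ?row_sub // /dot !mxE; apply: eq_bigr => j _; by rewrite !mxE.
have rK : \rank (kermx K^T) = \rank U.
  rewrite mxrank_ker mxrank_tr /K mxrank_ker mxrank_tr rU subKn // -rU; exact: rank_leq_col.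
have : (U == kermx K^T)%MS by rewrite -(mxrank_leqif_eq sub) rK.
by move=> /eqmxP UE; rewrite UE.
Qed.

Lemma rank_orthogonal (R : rcfType) m d (U : 'M[R]_(m, d)) :
  (forall l, dot (row l U) (row l U) != 0) ->
  (forall l l', l != l' -> dot (row l U) (row l' U) = 0) -> \rank U = m.
Proof.
move=> U0 Uo; apply/eqP; rewrite -/(row_free U) -kermx_eq0; apply/eqP/row_matrixP => i.
rewrite row0; set w := row i _.
have wU : w *m U = 0 by apply/sub_kermxP; exact: row_sub.
apply/rowP => l; rewrite [RHS]mxE; have : (w *m U *m U^T) 0 l = 0 by rewrite wU mul0mx mxE.
rewrite -mulmxA mxE (bigD1 l) //= [X in _ + X]big1 ?addr0 => [|l' ne].
  have -> : (U *m U^T) l l = dot (row l U) (row l U).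
    by rewrite dotE mxE; apply: eq_bigr => a _; rewrite !mxE.
  by move=> /eqP; rewrite mulf_eq0 (negPf (U0 l)) orbF => /eqP.
have -> : (U *m U^T) l' l = dot (row l' U) (row l U).
  by rewrite dotE mxE; apply: eq_bigr => a _; rewrite !mxE.
by rewrite Uo // mulr0.
Qed.

Section HyperplaneSets.
Variables (R : rcfType) (d k c : nat) (A : 'I_k -> seq (hyp R d)).

Notation simplex := {i : 'I_k & {set 'I_(size (A i))}}.
Notation tag_simplex U := (Tagged (fun i : 'I_k => {set 'I_(size (A i))}) U).

Definition is_vertex i (U : {set 'I_(size (A i))}) (q : 'rV[R]_d) :=
  forall x, (forall j, j \in U -> on_hyp (nth (0, 0) (A i) j) x) <-> x = q.

(** The default 0 is never met in [simplices], which keeps only the sets that have a vertex. *)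
Definition vertex (e : simplex) : 'rV[R]_d :=
  if excluded_middle_informative (exists q, is_vertex (tagged e) q) is left h
  then sval (constructive_indefinite_description _ h) else 0.

Lemma vertexE i (U : {set 'I_(size (A i))}) q : is_vertex U q -> vertex (tag_simplex U) = q.
Proof.
move=> Uq; rewrite /vertex; case: excluded_middle_informative => [h|[]]; last by exists q.
case: constructive_indefinite_description => v /= Uv; exact/(Uq _).1/(Uv _).2.
Qed.

Definition simplices i (T : {set 'I_(size (A i))}) : {set simplex} :=
  [set tag_simplex U | U in
    [set U : {set 'I_(size (A i))} |
      [&& U \subset T, #|U| == d & asbool (exists q, is_vertex U q)]]].

(* The subarrangements large enough for the theorem, each encoded as the set of its d-subsets
   that have a vertex. *)
Definition large_subsets i : {set {set simplex}} :=
  [set simplices T | T in [set T : {set 'I_(size (A i))} | (size (A i) <= mult d c.+1 #|T|)%N]].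

Lemma large_subsets_unavoidable (d_gt0 : (0 < d)%N) i (col : simplex -> 'I_c.+1) :
  exists2 T, T \in large_subsets i & exists k, forall e, e \in T -> col e = k.
Proof.
pose chi (U : {set 'I_(size (A i))}) : nat := col (tag_simplex U).
have [X [Xc [t Xt]]] := @mult_unavoidable d c _ chi d_gt0 (fun U => ltn_ord _).
rewrite card_ord in Xc; exists (simplices X); first by apply: imset_f; rewrite inE.
exists (inord t) => e /imsetP[U]; rewrite inE => /and3P[UX /eqP Ud _] ->.
by apply: val_inj; rewrite /= -(Xt U UX Ud) inordK //; exact: ltn_ord.
Qed.

Lemma large_subset_mu i T (a : 'rV[R]_d) b : T \in large_subsets i ->
  (forall e, e \in T -> b < dot a (vertex e)) ->
  (size (A i) <= mult d c.+1 (mu (A i) (fun x => (b < dot a x)%R)))%N.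
Proof.
move=> /imsetP[X]; rewrite inE => Xc -> HX; apply: leq_trans Xc _; apply: mult_mono.
apply: (@leq_bigmax_cond _ _ (fun T : {set 'I_(size (A i))} => #|T|)).
apply/asboolP => q [U [UX [Ud Uq]]]; rewrite -(vertexE Uq); apply: HX.
apply: imset_f; rewrite inE UX Ud eqxx /=; apply/asboolP; by exists q.
Qed.

End HyperplaneSets.

Theorem mainTheorem8 (R : rcfType) (d k : nat) (A : 'I_k -> seq (hyp R d)) :
  (2 <= d)%N -> (1 <= k <= d)%N ->
  (forall i, hyp_set (A i)) ->
  (forall i, (d.-1 <= size (A i))%N) ->
  exists (p : 'rV[R]_d) (M : 'M[R]_d),
    \rank M = k.-1 /\
    forall (a : 'rV[R]_d) (b : R), a != 0 ->
      (forall x, in_flat p M x -> b < dot a x) ->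
      forall i : 'I_k,
        leq (size (A i)) (mult d (d - k + 2) (mu (A i) (fun x => b < dot a x))).
Proof.
(* With [n = k - 1] and [m = d - k + 1], the multiple [d - k + 2] is [m + 1], the number of
   colours. *)
case: k A => [//|n] A d2 /andP[_ nd] _ _; pose m := (d - n)%N.
have -> : (d - n.+1 + 2 = m.+1)%N by rewrite /m; lia.
have nmd : (n + m <= d)%N by rewrite /m; lia.
have d0 : (0 < d)%N by apply: ltnW.
have := @transversal_sentence_rcf R n m d _ _ nmd (@large_subsets_unavoidable R d n.+1 m A d0).
move=> /(_ (fun ea => vertex ea.1 0 ea.2))[pU [U0 Uo HU]].
pose U : 'M[R]_(m, d) := \matrix_(l, a) pU (inr (l, a)).
pose p : 'rV[R]_d := \row_a pU (inl a).
have dotU l l' : dot (row l U) (row l' U) = \sum_a pU (inr (l, a)) * pU (inr (l', a)).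
  by rewrite dotE; apply: eq_bigr => a _; rewrite !mxE.
have rU : \rank U = m.
  apply: rank_orthogonal => [l|l l' ne]; rewrite dotU; first by apply/eqP; exact: U0.
  exact: Uo.
exists p, (kermx U^T); split.
  by rewrite mxrank_ker mxrank_tr rU /m subKn //; exact: ltnW.
move=> a b _ Hab i; have [lam aE] := flat_halfspace rU Hab.
have [T Tf HT] := HU (fun l => lam 0 l) i.
(* [p] is on the flat, hence in the open halfspace, and every vertex of [T] is at least as far in
   direction [a]. *)
apply: (large_subset_mu Tf) => e eT; apply: lt_le_trans (Hab p _) _.
  by rewrite /in_flat subrr sub0mx.
have dE (v : 'rV[R]_d) : dot a v = \sum_a v 0 a * (\sum_l lam 0 l * pU (inr (l, a))).
  rewrite dotE aE; apply: eq_bigr => j _; rewrite mulrC mxE; congr (_ * _).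
  by apply: eq_bigr => l _; rewrite mxE.
rewrite !dE; under eq_bigr do rewrite mxE; exact: HT.
Qed.
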